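(* Let $(w_1,w_2)$ and $(v_1,v_2)$ be in $\mathcal{M}_{\rho^-,\rho^+}\times\mathcal{M}_{\rho^+,\rho^-}$, with corresponding probability densities $(\eta_1,\eta_2)$ and $(\zeta_1,\zeta_2)$, and let $\lambda\mapsto(m_\lambda,n_\lambda)$ be the displacement interpolation between $(w_1,w_2)$ (at $\lambda=0$) and $(v_1,v_2)$ (at $\lambda=1$). Suppose that the probability densities $\eta_i$ and $\zeta_i$, $i=1,2$, have finite first moments. Then for $0<\lambda<1$, $$\mathcal{G}(m_\lambda,n_\lambda)\le(1-\lambda)\,\mathcal{G}(w_1,w_2)+\lambda\,\mathcal{G}(v_1,v_2).$$ If $J$ is strictly positive on some (nonempty open) interval, and the densities $\eta_1,\eta_2$ are strictly positive almost everywhere, then there is equality if and only if $(v_1,v_2)$ is a translate of $(w_1,w_2)$, i.e. there is $c\in\mathbb{R}$ with $v_i(x)=w_i(x-c)$ for all $x\in\mathbb{R}$ and $i=1,2$.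
   Context: Setting. $J:[0,\infty)\to[0,\infty)$ is decreasing (non-increasing) and compactly supported; for a dimension $\nu\ge1$ put $\bar J(s)=\int_{\mathbb{R}^{\nu-1}}J(\sqrt{s^2+|t|^2})\,dt$ for $s\in\mathbb{R}$ (with $\bar J(s)=J(|s|)$ if $\nu=1$) and $\hat J=\int_{\mathbb{R}}\bar J(s)\,ds$. Fix $\kappa\in\mathbb{R}$ (the chemical potential) and $\beta>0$, and for $m,n\ge0$ let $$f(m,n)=m\ln m+n\ln n+\beta\hat J\,mn-\kappa m-\kappa n\qquad(0\ln 0=0),\qquad g=\inf_{m,n\ge0}f(m,n).$$ There is a critical value $\beta_c$ such that $f$ has a unique minimizer for $\beta\le\beta_c$, while for $\beta>\beta_c$ there are densities $\rho^-<\rho^+$ such that the minimizers of $f$ are exactly $(\rho^+,\rho^-)$ and $(\rho^-,\rho^+)$. It is assumed that $\beta>\beta_c$. The excess free energy functional is $$\mathcal{G}(m,n)=\int_{\mathbb{R}}\Big[m(x)\ln m(x)+n(x)\ln n(x)-\kappa m(x)-\kappa n(x)+\beta\int_{\mathbb{R}}\bar J(x-y)m(x)n(y)\,dy-g\Big]dx.$$ $\mathcal{M}_{\rho^-,\rho^+}$ is the set of right-continuous monotone increasing functions on $\mathbb{R}$ with limits $\rho^-$ at $-\infty$ and $\rho^+$ at $+\infty$; $\mathcal{M}_{\rho^+,\rho^-}$ is the set of right-continuous monotone decreasing functions on $\mathbb{R}$ with limits $\rho^+$ at $-\infty$ and $\rho^-$ at $+\infty$. The probability densities $\eta_1,\eta_2$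 corresponding to $(w_1,w_2)$ (assumed to exist) are defined by $w_1(x)=\rho^-+(\rho^+-\rho^-)\int_{-\infty}^x\eta_1(t)\,dt$ and $w_2(x)=\rho^++(\rho^--\rho^+)\int_{-\infty}^x\eta_2(t)\,dt$, and similarly $\zeta_1,\zeta_2$ for $(v_1,v_2)$. Displacement interpolation: let $T_i$ be the monotone (non-decreasing) map pushing $\eta_i\,dx$ forward to $\zeta_i\,dx$, let $T_i^\lambda(x)=(1-\lambda)x+\lambda T_i(x)$, and let $\mu_i^\lambda$ be the push-forward of $\eta_i\,dx$ under $T_i^\lambda$; then $m_\lambda(x)=\rho^-+(\rho^+-\rho^-)\mu_1^\lambda((-\infty,x])$ and $n_\lambda(x)=\rho^++(\rho^--\rho^+)\mu_2^\lambda((-\infty,x])$. *)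

(* Defs.v *)
From HB Require Import structures.
From mathcomp Require Import all_boot all_order all_algebra.
From mathcomp Require Import all_classical all_reals all_analysis.

Set Implicit Arguments.
Unset Strict Implicit.
Unset Printing Implicit Defensive.

Import Order.TTheory GRing.Theory Num.Theory.
Import numFieldNormedType.Exports.

Local Open Scope classical_set_scope.
Local Open Scope ring_scope.

Section lebesgue_tuple.
Context {R : realType}.

(* Lebesgue measure on the Borel sets of R^k. For k = 0 it is the unit mass on
   the one-point space R^0. *)
Fixpoint lebesgue_tuple (k : nat) :
    set (k.-tuple (measurableTypeR R)) -> \bar R :=
  match k with
  | 0%N => \d_([tuple] : 0.-tuple (measurableTypeR R))
  | k'.+1 =>
    pushforward (lebesgue_measure \x^ @lebesgue_tuple k')%E
      (fun p : measurableTypeR R * k'.-tuple (measurableTypeR R) =>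
         [the k'.+1.-tuple (measurableTypeR R) of p.1 :: p.2])
  end.

Lemma lebesgue_tuple_is_measure (k : nat) :
  { m : {measure set (k.-tuple (measurableTypeR R)) -> \bar R}
  | @lebesgue_tuple k = m :> (_ -> _) }.
Proof.
elim: k => [|k [m IH]]; first by exists (\d_([tuple] : 0.-tuple _)).
have mf : measurable_fun [set: measurableTypeR R * k.-tuple (measurableTypeR R)]
    (fun p => [the k.+1.-tuple (measurableTypeR R) of p.1 :: p.2]).
  by apply: measurable_cons; [exact: measurable_fst|exact: measurable_snd].
pose mm : {measure set (k.+1.-tuple (measurableTypeR R)) -> \bar R} :=
  measure_function_pushforward__canonical__measure_function_Measure
    (lebesgue_measure \x^ m)%E mf.
by exists mm; rewrite /= IH.
Qed.

Lemma lebesgue_tuple0 k : @lebesgue_tuple k set0 = 0%E.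
Proof. by have [m ->] := lebesgue_tuple_is_measure k. Qed.

Lemma lebesgue_tuple_ge0 k A : (0 <= @lebesgue_tuple k A)%E.
Proof. by have [m ->] := lebesgue_tuple_is_measure k. Qed.

Lemma lebesgue_tuple_sigma_additive k : semi_sigma_additive (@lebesgue_tuple k).
Proof.
by have [m ->] := lebesgue_tuple_is_measure k; exact: measure_semi_sigma_additive.
Qed.

HB.instance Definition _ k := isMeasure.Build _ _ _ (@lebesgue_tuple k)
  (lebesgue_tuple0 k) (@lebesgue_tuple_ge0 k) (@lebesgue_tuple_sigma_additive k).

Lemma lebesgue_tuple_box (k : nat)
    (A : 'I_k -> set (measurableTypeR R)) :
  (forall i, measurable (A i)) ->
  lebesgue_tuple [set t : k.-tuple (measurableTypeR R) |
                  forall i, A i (tnth t i)]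
  = (\prod_(i < k) lebesgue_measure (A i))%E.
Proof.
elim: k A => [|k IH] A mA.
  rewrite big_ord0 /= diracE (_ : _ \in _ = true)//.
  by apply/mem_set => -[].
rewrite big_ord_recl -IH//= /pushforward.
rewrite (_ : _ @^-1` _ = A ord0 `*` [set t : k.-tuple (measurableTypeR R) |
   forall i, A (lift ord0 i) (tnth t i)]); last first.
  apply/seteqP; split => -[x t] /=.
    move=> H; split; first exact: (H ord0).
    by move=> i; have := H (lift ord0 i); rewrite tnthS.
  move=> [Hx Ht] i; case: (unliftP ord0 i) => [j ->|->//].
  by rewrite tnthS.
rewrite (@product_measure2E _ _ _ _ _ lebesgue_measure (@lebesgue_tuple k))//.
rewrite (_ : [set t | _] = \bigcap_(i in [set: 'I_k])
    ((fun t : k.-tuple (measurableTypeR R) => tnth t i) @^-1` A (lift ord0 i)));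
  last by apply/seteqP; split => t /= Ht i; [move=> _; exact: Ht|exact: (Ht i I)].
apply: fin_bigcap_measurable => // i _.
rewrite -[X in measurable X]setTI.
exact: measurable_tnth.
Qed.

End lebesgue_tuple.

Section model.
Context {R : realType}.
Local Notation mu := (@lebesgue_measure R).

Definition Jbar (nu : nat) (J : R -> R) (s : R) : R :=
  \int[@lebesgue_tuple R nu.-1]_(t in [set: nu.-1.-tuple (measurableTypeR R)])
    J (Num.sqrt (s ^+ 2 + \sum_(i < nu.-1) tnth t i ^+ 2)).

Definition Jhat (nu : nat) (J : R -> R) : R := \int[mu]_s Jbar nu J s.

Definition free_energy (nu : nat) (J : R -> R) (kappa beta m n : R) : R :=
  m * ln m + n * ln n + beta * Jhat nu J * m * n - kappa * m - kappa * n.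

Definition free_energy_inf (nu : nat) (J : R -> R) (kappa beta : R) : R :=
  inf [set free_energy nu J kappa beta p.1 p.2
      | p in [set p : R * R | 0 <= p.1 /\ 0 <= p.2]].

Definition minimizer (f : R -> R -> R) (m n : R) : Prop :=
  [/\ 0 <= m, 0 <= n &
      forall m' n', 0 <= m' -> 0 <= n' -> f m n <= f m' n'].

Definition unique_minimizer (f : R -> R -> R) : Prop :=
  exists m n, forall m' n', minimizer f m' n' <-> m' = m /\ n' = n.

Definition two_minimizers (f : R -> R -> R) (rhom rhop : R) : Prop :=
  rhom < rhop /\
  forall m n, minimizer f m n <->
    (m = rhop /\ n = rhom) \/ (m = rhom /\ n = rhop).

Definition critical_beta (nu : nat) (J : R -> R) (kappa betac : R) : Prop :=
  (forall beta, 0 < beta -> beta <= betac ->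
     unique_minimizer (free_energy nu J kappa beta)) /\
  (forall beta, 0 < beta -> betac < beta ->
     exists rhom rhop, two_minimizers (free_energy nu J kappa beta) rhom rhop).

(* For monotone profiles with the limits at infinity used below, the negative
   part of the integrand is integrable, so that the integral is meaningful in
   ]-oo, +oo]. *)
Definition excess_free_energy (nu : nat) (J : R -> R) (kappa beta : R)
    (m n : R -> R) : \bar R :=
  (\int[mu]_x (m x * ln (m x) + n x * ln (n x) - kappa * m x - kappa * n x
     + beta * (\int[mu]_y (Jbar nu J (x - y) * m x * n y))
     - free_energy_inf nu J kappa beta)%R%:E)%E.

Definition increasing_profile (rhom rhop : R) (w : R -> R) : Prop :=
  [/\ {homo w : x y / x <= y},
      forall x, w y @[y --> x^'+] --> w x,
      w y @[y --> -oo] --> rhom &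
      w y @[y --> +oo] --> rhop].

Definition decreasing_profile (rhop rhom : R) (w : R -> R) : Prop :=
  [/\ {homo w : x y /~ x <= y},
      forall x, w y @[y --> x^'+] --> w x,
      w y @[y --> -oo] --> rhop &
      w y @[y --> +oo] --> rhom].

Definition probability_density (eta : R -> R) : Prop :=
  [/\ measurable_fun [set: R] eta, forall x, 0 <= eta x &
      (\int[mu]_x (eta x)%:E = 1)%E].

Definition finite_first_moment (eta : R -> R) : Prop :=
  (\int[mu]_x (`|x| * eta x)%:E < +oo)%E.

(* eta is the density of the profile w going from a at -oo to b at +oo. *)
Definition profile_density (a b : R) (w eta : R -> R) : Prop :=
  probability_density eta /\
  forall x, w x = a + (b - a) * \int[mu]_(t in `]-oo, x]) eta t.

Definition density_measure (eta : R -> R) (A : set (measurableTypeR R)) :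
    \bar R :=
  (\int[mu]_(x in A) (eta x)%:E)%E.

(* The transport map is only determined eta-almost everywhere, and it need not
   extend to a finite monotone function on all of R (e.g. when eta has compact
   support and zeta does not): monotonicity is required on a set of full
   eta-measure. *)
Definition monotone_transport (eta zeta T : R -> R) : Prop :=
  [/\ measurable_fun [set: R] T,
      exists D : set (measurableTypeR R),
        [/\ measurable D, density_measure eta (~` D) = 0%E &
            forall x y, D x -> D y -> x <= y -> T x <= T y] &
      forall A : set (measurableTypeR R), measurable A ->
        pushforward (density_measure eta)
          (T : measurableTypeR R -> measurableTypeR R) A
        = density_measure zeta A].

Definition interpolated_map (lambda : R) (T : R -> R)
    (x : measurableTypeR R) : measurableTypeR R :=
  (1 - lambda) * x + lambda * T x.

Definition displacement (a b : R) (eta T : R -> R) (lambda x : R) : R :=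
  a + (b - a) *
    fine (pushforward (density_measure eta) (interpolated_map lambda T)
            `]-oo, x]).

End model.

(* Main.v *)
Require Import Defs.
From HB Require Import structures.
From mathcomp Require Import all_boot all_order all_algebra.
From mathcomp Require Import all_classical all_reals all_analysis.
From mathcomp Require Import measurable_realfun ring lra.
Import Order.TTheory GRing.Theory Num.Theory.
Import numFieldNormedType.Exports.
Set Implicit Arguments.
Unset Strict Implicit.
Unset Printing Implicit Defensive.
Local Open Scope ring_scope.
Local Open Scope classical_set_scope.

(** Write [a = rhom], [b = rhop], [c = b - a], and let [P1], [P2] be the
    probabilities with densities [eta1], [eta2].  On these spaces the
    displacement interpolation is linear: with [A = (1 - l) id + l T1] and
    [B = (1 - l) id + l T2], the interpolated profiles are [m = a + c F1] and
    [n = b - c F2], where [F1 x = P1 {A <= x}] and [F2 x = P2 {B <= x}].  The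
    excess free energy turns out to be a sum of a functional that is affine in
    [(A, B)] and of one that is convex in [(A, B)].

    The local terms are affine.  As [A] is nondecreasing off a null set,
    [{A <= x}] is, up to a null set, the initial segment of mass [F1 x].  The
    distribution function of the atomless [P1] is uniform under [P1], so
    [phi (m x) - phi a], with [phi t = t * ln t - kappa * t], is the integral
    over [{A <= x}] of a weight that does not depend on [l]
    ([integral_downset]).  Once a step at the origin is
    subtracted, integrating in [x] turns [{A <= x}] into the position [- A]
    ([integral_weighted_cdf]): the result is linear in [A].

    For the interaction, let [u] follow the finite measure of density [Jbar],
    independently of [B], and put [Y = B + u].  The convolution of [Jbar] with [F2] is the mass of
    [{Y <= x}] ([integral_convolution_cdf]), and expanding the product [m n]
    leaves, besides terms of the previous kind, the product of the masses of
    [{A <= x}] and [{x < Y}].  Its integral in [x] is the mean of the positive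
    part of [Y - A] ([integral_cdf_ccdf]), which is convex in [(A, B)].  The
    constants and the steps at the origin cancel because [(b, a)] minimizes the
    free energy density.  First moments make every term finite
    ([energy_formula]).

    Equality forces the positive part to be affine between [y + u - t] and
    [T2 y + u - T1 t] for almost every [(t, y, u)]: zero is never strictly
    between these numbers.  When [Jbar] charges every interval inside
    [(-r, r)], letting [u] vary gives [T1 t - t = T2 y - y] for almost all
    [t], [y] at distance less than [r], and following chains of nearby points
    both shifts equal one constant ([ae_constant_of_local]).  Conversely,
    for positive densities the only monotone map onto a translate is the
    translation ([transport_translate]); the differences [Y - A] then do not depend on
    [l], and the energy is affine. *)

(** * Measures with a density and finite products *)

Section density.
Context {R : realType}.
Local Notation mu := (@lebesgue_measure R).
Local Notation mR := (measurableTypeR R).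

Definition integrable_density (f : R -> R) : Prop :=
  [/\ measurable_fun [set: R] f, forall x, 0 <= f x &
      (\int[mu]_x (f x)%:E < +oo)%E].

(** [density_measure f], carrying the proof that makes it a finite measure. *)
Definition finite_density (f : R -> R) (hf : integrable_density f) :
  set mR -> \bar R := density_measure f.

Section finite_density_measure.
Variables (f : R -> R) (hf : integrable_density f).

Let P0 : finite_density hf set0 = 0%E.
Proof. exact: integral_set0. Qed.

Let Pge0 A : (0 <= finite_density hf A)%E.
Proof. by have [_ f0 _] := hf; apply: integral_ge0 => x _; rewrite lee_fin f0. Qed.

Let Psa : semi_sigma_additive (finite_density hf).
Proof.
have [mf f0 _] := hf; move=> F mF tF mUF; rewrite /finite_density; apply: cvg_toP.
  apply: ereal_nondecreasing_is_cvgn => m n mn.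
  apply: lee_sum_nneg_natr => // k _ _; exact: Pge0.
rewrite /density_measure ge0_integral_bigcup//=.
  by apply: measurable_funTS; apply/measurable_EFinP.
by move=> x _; rewrite lee_fin.
Qed.

HB.instance Definition _ := isMeasure.Build _ _ _ (finite_density hf) P0 Pge0 Psa.

Let Pfin : fin_num_fun (finite_density hf).
Proof.
have [mf f0 ffin] := hf; move=> A mA; rewrite ge0_fin_numE//; apply: le_lt_trans ffin.
apply: ge0_subset_integral => //; first exact/measurable_EFinP.
by move=> x _; rewrite lee_fin.
Qed.

HB.instance Definition _ := Measure_isFinite.Build _ _ _ (finite_density hf) Pfin.

End finite_density_measure.

Lemma probability_density_integrable (f : R -> R) :
  probability_density f -> integrable_density f.
Proof. by move=> [mf f0 f1]; split => //; rewrite f1 ltry. Qed.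

Definition density_prob (f : R -> R) (hf : probability_density f) :
  set mR -> \bar R := finite_density (probability_density_integrable hf).

Section density_probability.
Variables (f : R -> R) (hf : probability_density f).

HB.instance Definition _ := Measure.on (density_prob hf).

Let P1 : density_prob hf setT = 1%E.
Proof. by have [] := hf. Qed.

HB.instance Definition _ := @Measure_isProbability.Build _ _ R (density_prob hf) P1.

End density_probability.

Import HBNNSimple.

Lemma ge0_integral_density (f : R -> R) (hf : integrable_density f)
    (g : mR -> \bar R) : measurable_fun [set: mR] g -> (forall x, 0 <= g x)%E ->
  (\int[finite_density hf]_x g x = \int[mu]_x (g x * (f x)%:E))%E.
Proof.
have [mf f0 ffin] := hf; move=> mg g0;
have {}mf : measurable_fun [set: mR] f by exact: mf.
 set P := finite_density hf.
pose h := nnsfun_approx measurableT mg.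
have hE x : g x = limn (fun n => (h n x)%:E).
  by apply/esym/cvg_lim => //; exact: cvg_nnsfun_approx.
have h_ge0 n x : 0 <= h n x by [].
have h_nd x a b : (a <= b)%N -> h a x <= h b x.
  by move=> ab; exact/lefP/nd_nnsfun_approx.
transitivity (limn (fun n => \int[P]_x (h n x)%:E)%E).
  under eq_integral do rewrite hE.
  apply: monotone_convergence; [by []|..].
  - by move=> n; exact/measurable_EFinP.
  - by move=> n x _; rewrite lee_fin; exact: h_ge0.
  - by move=> x _ a b ab; rewrite lee_fin; apply: h_nd.
transitivity (limn (fun n => \int[mu]_x ((h n x)%:E * (f x)%:E))%E); last first.
  transitivity (\int[mu]_x limn (fun n => (h n x)%:E * (f x)%:E))%E.
    apply/esym; apply: monotone_convergence; [by []|..].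
    - move=> n; apply: emeasurable_funM; last exact/measurable_EFinP.
      exact/measurable_EFinP.
    - by move=> n x _; rewrite -EFinM lee_fin mulr_ge0.
    - move=> x _ a b ab; rewrite -!EFinM lee_fin ler_wpM2r//.
      exact: h_nd.
  apply: eq_integral => x _; apply/cvg_lim => //; apply: cvgeZr => //.
  exact: cvg_nnsfun_approx.
apply: congr_lim; apply/funext => n.
under eq_integral do rewrite fimfunE -fsumEFin//.
rewrite ge0_integral_fsum//; last 2 first.
- by move=> r; exact/measurable_EFinP/measurableT_comp.
- by move=> y x _; rewrite nnfun_muleindic_ge0.
transitivity (\int[mu]_x (\sum_(y \in range (h n))
    (y * \1_(h n @^-1` [set y]) x)%:E * (f x)%:E))%E; last first.
  apply: eq_integral => x _; rewrite -ge0_mule_fsuml; last first.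
    by move=> y; rewrite nnfun_muleindic_ge0.
  by rewrite fsumEFin// -(fimfunE (h n) x).
rewrite ge0_integral_fsum//; last 2 first.
- move=> y; apply: emeasurable_funM; last exact/measurable_EFinP.
  exact/measurable_EFinP/measurableT_comp.
- by move=> y x _; rewrite mule_ge0 ?lee_fin// -lee_fin EFinM nnfun_muleindic_ge0.
apply: eq_fsbigr => r _; rewrite integralZl_indic_nnsfun// integral_indic//= setIT.
under [RHS]eq_integral do rewrite EFinM -muleA.
have [r0|r0] := leP 0 r.
  rewrite ge0_integralZl//; last 2 first.
    - by apply: emeasurable_funM => //; exact/measurable_EFinP.
    - by move=> x _; rewrite mule_ge0// lee_fin.
  congr (_ * _)%E; rewrite /P /finite_density /density_measure [LHS]integral_mkcond; apply: eq_integral => x _.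
  by rewrite patchE indicE; case: ifPn => _; rewrite ?mul1e ?mul0e.
have -> : h n @^-1` [set r] = set0.
  by rewrite preimage_nnfun0.
rewrite measure0 mule0 integral0_eq// => x _.
by rewrite indic0 mul0e mule0.
Qed.
End density.

Section finite_product.
Context {R : realType} d1 d2 (T1 : measurableType d1) (T2 : measurableType d2).
Variables (P : {finite_measure set T1 -> \bar R}).
Variables (Q : {finite_measure set T2 -> \bar R}).

(** The product measure under its own name, so that it carries a canonical
    structure of finite, hence sigma-finite, measure. *)
Definition finite_prod : set (T1 * T2) -> \bar R := (P \x Q)%E.

HB.instance Definition _ := Measure.on finite_prod.

Let finite_prod_fin : fin_num_fun finite_prod.
Proof.
move=> A mA; rewrite ge0_fin_numE; last exact: measure_ge0.
apply: (@le_lt_trans _ _ (finite_prod setT)); first by apply: le_measure; rewrite ?inE.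
rewrite /finite_prod -setXTT product_measure1E//.
by rewrite lte_mul_pinfty// ?fin_num_measure// -ge0_fin_numE// fin_num_measure.
Qed.

HB.instance Definition _ := Measure_isFinite.Build _ _ _ finite_prod finite_prod_fin.

Lemma finite_prodX A B : measurable A -> measurable B ->
  finite_prod (A `*` B) = (P A * Q B)%E.
Proof. exact: product_measure1E. Qed.

Lemma ge0_integral_finite_prod1 (f : T1 * T2 -> \bar R) :
  measurable_fun setT f -> (forall z, 0 <= f z)%E ->
  (\int[finite_prod]_z f z = \int[P]_t \int[Q]_u f (t, u))%E.
Proof. exact: fubini_tonelli1. Qed.

Lemma ge0_integral_finite_prod2 (f : T1 * T2 -> \bar R) :
  measurable_fun setT f -> (forall z, 0 <= f z)%E ->
  (\int[finite_prod]_z f z = \int[Q]_u \int[P]_t f (t, u))%E.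
Proof. exact: fubini_tonelli2. Qed.

End finite_product.

(** * The probability integral transform *)

Section cdf.
Context {R : realType}.
Local Notation mu := (@lebesgue_measure R).
Local Notation mR := (measurableTypeR R).
Variable P : probability mR R.

Definition cdf_of (t : R) : R := fine (P `]-oo, t]).

Lemma EFin_cdf_of t : (cdf_of t)%:E = P `]-oo, t].
Proof. by rewrite fineK// fin_num_measure. Qed.

Lemma cdf_of_ge0 t : 0 <= cdf_of t.
Proof. exact: fine_ge0. Qed.

Lemma cdf_of_le1 t : cdf_of t <= 1.
Proof. by rewrite -lee_fin EFin_cdf_of probability_le1. Qed.

Lemma cdf_of_nondecreasing : {homo cdf_of : s t / s <= t}.
Proof.
move=> s t st; rewrite -lee_fin !EFin_cdf_of le_measure ?inE//.
by apply: subset_itvl; rewrite bnd_simp.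
Qed.

Lemma measurable_cdf_of : measurable_fun [set: R] cdf_of.
Proof. by apply: nondecreasing_measurable => // s t; exact: cdf_of_nondecreasing. Qed.

Lemma cdf_of_right c s :
  (forall e, 0 < e -> s <= cdf_of (c + e)) -> s <= cdf_of c.
Proof.
move=> h; rewrite -lee_fin EFin_cdf_of.
pose F n : set mR := `]-oo, (c + n.+1%:R^-1)%R].
have -> : `]-oo, c]%classic = \bigcap_n F n by exact: (itvNycEbigcap false).
have F0 : (P (F 0%N) < +oo)%E by rewrite (le_lt_trans (probability_le1 _ _)) ?ltry//; exact: measurable_itv.
have cvF : P \o F @ \oo --> P (\bigcap_n F n).
  apply: nonincreasing_cvg_mu; [by []|by move=> n; exact: measurable_itv|
    by apply: bigcap_measurable => // n _; exact: measurable_itv|].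
  move=> m n mn; apply/subsetPset; apply: subset_itvl.
  by rewrite bnd_simp lerD2l lef_pV2 ?posrE// ler_nat.
apply: (cvge_to_ge cvF); apply: nearW => n /=.
by rewrite /F -EFin_cdf_of lee_fin h// invr_gt0.
Qed.

Lemma cdf_of_left (P_atomless : forall x, P [set x] = 0%E) c s :
  (forall t, t < c -> cdf_of t <= s) -> cdf_of c <= s.
Proof.
move=> h; rewrite -lee_fin EFin_cdf_of.
have -> : P `]-oo, c] = P `]-oo, c[.
  rewrite (_ : `]-oo, c]%classic = `]-oo, c[ `|` [set c]); last first.
    apply/seteqP; split => t /=; rewrite !in_itv/=.
      by rewrite le_eqVlt => /predU1P[->|]; [right|left].
    by move=> [/ltW|->].
  rewrite measureU//= ?P_atomless ?adde0//.
  by apply/seteqP; split => // x /= [/[swap] ->]; rewrite in_itv/= ltxx.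
pose F n : set mR := `]-oo, (c - n.+1%:R^-1)%R].
have -> : `]-oo, c[%classic = \bigcup_n F n.
  apply/seteqP; split => t /=; rewrite in_itv/=.
    move=> /ltr_add_invr[k tk]; exists k => //.
    by rewrite /F/= in_itv/= lerBrDr ltW.
  move=> [k _]; rewrite /F/= in_itv/= => /le_lt_trans; apply.
  by rewrite ltrBlDr ltrDl invr_gt0.
have cvF : P \o F @ \oo --> P (\bigcup_n F n).
  apply: nondecreasing_cvg_mu; [by move=> n; exact: measurable_itv|
    by apply: bigcup_measurable => // n _; exact: measurable_itv|].
  move=> m n mn; apply/subsetPset; apply: subset_itvl.
  by rewrite bnd_simp lerD2l lerN2 lef_pV2 ?posrE// ler_nat.
apply: (cvge_to_le cvF); apply: nearW => n /=.
by rewrite /F -EFin_cdf_of lee_fin h// ltrBlDr ltrDl invr_gt0.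
Qed.

Lemma cdf_of_Ny s : (forall t, s <= cdf_of t) -> s <= 0.
Proof.
move=> h; rewrite -lee_fin -[X in (_ <= X)%E](measure0 P).
pose F n : set mR := `]-oo, (- n%:R)%R].
have <- : \bigcap_n F n = set0.
  rewrite -subset0 => t /(_ (Num.truncn (- t)).+1 I).
  by rewrite /F/= in_itv/= leNgt => /negP; apply; rewrite ltrNl Num.Theory.truncnS_gt.
have F0 : (P (F 0%N) < +oo)%E by rewrite (le_lt_trans (probability_le1 _ _)) ?ltry//; exact: measurable_itv.
have cvF : P \o F @ \oo --> P (\bigcap_n F n).
  apply: nonincreasing_cvg_mu; [by []|by move=> n; exact: measurable_itv|
    by apply: bigcap_measurable => // n _; exact: measurable_itv|].
  move=> m n mn; apply/subsetPset; apply: subset_itvl.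
  by rewrite bnd_simp lerN2 ler_nat.
apply: (cvge_to_ge cvF); apply: nearW => n /=.
by rewrite /F -EFin_cdf_of lee_fin h.
Qed.

Lemma cdf_of_y s : (forall t, cdf_of t <= s) -> 1 <= s.
Proof.
move=> h; rewrite -lee_fin -[X in (X <= _)%E](probability_setT P).
pose F n : set mR := `]-oo, n%:R].
have <- : \bigcup_n F n = setT.
  rewrite -subTset => t _/=.
  by exists (Num.truncn t).+1; rewrite /F //= in_itv/= ltW// Num.Theory.truncnS_gt.
have cvF : P \o F @ \oo --> P (\bigcup_n F n).
  apply: nondecreasing_cvg_mu; [by move=> n; exact: measurable_itv|
    by apply: bigcup_measurable => // n _; exact: measurable_itv|].
  move=> m n mn; apply/subsetPset; apply: subset_itvl.
  by rewrite bnd_simp ler_nat.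
apply: (cvge_to_le cvF); apply: nearW => n /=.
by rewrite /F -EFin_cdf_of lee_fin h.
Qed.

Section probability_integral_transform.
Hypothesis P_atomless : forall x, P [set x] = 0%E.

Lemma measurable_cdf_of_le s : measurable ([set t | cdf_of t <= s] : set mR).
Proof.
have := measurable_cdf_of measurableT (measurable_itv `]-oo, s]%R).
rewrite setTI; congr measurable; apply/seteqP; split => t /=; by rewrite in_itv.
Qed.

(** When [s < 1] and [K = {F <= s}] is not empty, let [c] be its supremum: right
    continuity at [c] gives [s <= F c] and the absence of atoms gives [F c <= s],
    so that [K] is the half-line up to [c], of mass exactly [s]. *)
Lemma cdf_of_uniform s : 0 <= s <= 1 -> P [set t | cdf_of t <= s] = s%:E.
Proof.
move=> /andP[s0 s1].
have [->|s_neq1] := eqVneq s 1.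
  rewrite -(probability_setT P); congr (P _); apply/seteqP; split => // t _ /=.
  exact: cdf_of_le1.
have {}s1 : s < 1 by rewrite lt_neqAle s_neq1.
set K := [set t | _].
have [K0|/set0P[t0 Kt0]] := eqVneq K set0.
  have s_le0 : s <= 0.
    apply: cdf_of_Ny => t; rewrite leNgt; apply/negP => ts.
    have Kt : K t by exact: ltW.
    by rewrite K0 in Kt.
  by rewrite K0 measure0; congr EFin; apply/eqP; rewrite eq_le s0 s_le0.
have [M sM] : exists M, s < cdf_of M.
  apply: contrapT => /forallNP h; move: s1; apply/negP; rewrite -leNgt.
  by apply: cdf_of_y => t; rewrite leNgt; exact/negP/h.
have KM t : K t -> t <= M.
  rewrite /K/= => ts; rewrite leNgt; apply/negP => Mt.
  by move: (le_trans (cdf_of_nondecreasing (ltW Mt)) ts); rewrite leNgt sM.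
have hsK : has_sup K by split; [exists t0|exists M => t /KM].
pose c := sup K.
have lt_c t : t < c -> cdf_of t <= s.
  move=> tc; have [u Ku tu] := sup_gt (ex_intro _ t0 Kt0) tc.
  exact: le_trans (cdf_of_nondecreasing (ltW tu)) Ku.
have cs : cdf_of c <= s by exact: cdf_of_left.
have sc : s <= cdf_of c.
  apply: cdf_of_right => e e0; rewrite leNgt; apply/negP => /ltW ces.
  have : c + e <= c by apply: ub_le_sup => //; case: hsK.
  by rewrite gerDl leNgt e0.
have -> : K = `]-oo, c]%classic.
  apply/seteqP; split => t /=; rewrite in_itv/=.
    by move=> Kt; apply: ub_le_sup => //; case: hsK.
  by move=> tc; exact: le_trans (cdf_of_nondecreasing tc) cs.
by rewrite -EFin_cdf_of; congr EFin; apply/eqP; rewrite eq_le cs sc.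
Qed.

End probability_integral_transform.
End cdf.

Lemma measureI_conull d (T : measurableType d) (R : realType)
    (P : {measure set T -> \bar R}) (A D : set T) :
  measurable A -> measurable D -> P (~` D) = 0%E -> P (A `&` D) = P A.
Proof.
move=> mA mD PD; rewrite -[in RHS](setIT A) -(setUv D) setIUr measureU//=.
- rewrite [X in (_ + X)%E](_ : _ = 0%E) ?adde0//.
  apply/eqP; rewrite eq_le measure_ge0 andbT -PD.
  by apply: le_measure; rewrite ?inE//; [exact/measurableI/measurableC|exact: measurableC].
- exact: measurableI.
- exact/measurableI/measurableC.
- by rewrite setIACA setICr setI0.
Qed.

Section layer.
Context {R : realType}.
Local Notation mu := (@lebesgue_measure R).
Local Notation mR := (measurableTypeR R).
Variable P : probability mR R.
Hypothesis P_atomless : forall x, P [set x] = 0%E.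

Let F : mR -> mR := cdf_of P.

Let mF : measurable_fun [set: mR] F.
Proof. exact: measurable_cdf_of. Qed.

Let Pray s : P (F @^-1` `]-oo, s]) = (Num.max 0 (Num.min s 1))%:E.
Proof.
have FE u : F @^-1` `]-oo, u] = [set t | cdf_of P t <= u].
  by apply/seteqP; split => t /=; rewrite in_itv.
have [s0|s0] := leP s 0.
  rewrite max_l; last by rewrite ge_min s0.
  apply/eqP; rewrite eq_le measure_ge0 andbT.
  rewrite -(cdf_of_uniform P_atomless (s := 0)) ?lexx ?ler01//.
  rewrite FE le_measure ?inE//; [exact: measurable_cdf_of_le..|].
  by move=> t /= /le_trans; apply.
have [s1|s1] := leP s 1; last first.
  rewrite max_r ?ler01// -(probability_setT P); congr (P _).
  apply/seteqP; split => // t _ /=; rewrite in_itv/=.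
  exact: le_trans (cdf_of_le1 _ _) (ltW s1).
by rewrite max_r ?(ltW s0)// FE cdf_of_uniform// (ltW s0) s1.
Qed.

Let uniform_ray (s : R) :
  uniform_prob (@ltr01 R) `]-oo, s] = (Num.max 0 (Num.min s 1))%:E.
Proof.
rewrite /uniform_prob integral_uniform_pdf.
rewrite (eq_integral (cst 1%E)); last first.
  move=> t; rewrite inE/= !in_itv/= => -[_ t01].
  by rewrite /uniform_pdf t01 subr0 invr1.
rewrite integral_cst ?mul1e//=; last exact: measurableI.
have -> : `]-oo, s] `&` `[0, 1] = `[0, Num.min s 1] :> set R.
  apply/seteqP; split => t /=; rewrite !in_itv/= le_min.
    by move=> [-> /andP[-> ->]].
  by move=> /and3P[-> -> ->].
rewrite lebesgue_measure_itv/= lte_fin oppr0 adde0.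
by case: ltP => // /ltW; rewrite /Num.max; case: ltP => // h h'; rewrite (le_anti (introT andP (conj h h'))).
Qed.

Let pushforward_cdf_of_uniform (A : set mR) : measurable A ->
  pushforward P F A = uniform_prob (@ltr01 R) A.
Proof.
pose m1 : {measure set mR -> \bar R} :=
  measure_function_pushforward__canonical__measure_function_Measure P mF.
move=> mA; rewrite -[LHS]/(m1 A); move: A mA.
pose g n : set mR := `](- n%:R), n%:R].
apply: (@measure_unique _ R mR (@ocitv R) g).
- by [].
- exact: (@ocitvI R).
- by move=> n; exact: is_ocitv.
- apply/seteqP; split => // x _; exists (Num.truncn `|x|).+1 => //=.
  have := Num.Theory.truncnS_gt `|x|; rewrite ltr_norml /g/= in_itv/= => /andP[-> h].
  exact: ltW.
- move=> _ [[a b]] _ <-.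
  have [ba|ab] := leP b a.
    by rewrite set_itv_ge ?measure0// bnd_simp -leNgt.
  have -> : `]a, b]%classic = `]-oo, b] `\` `]-oo, a] :> set mR.
    rewrite -[RHS]setCK setCD setCitvl setUC -[LHS]setCK setCitv//.
  have sub : `]-oo, a] `<=` `]-oo, b].
    by apply: subset_itvl; rewrite bnd_simp ltW.
  rewrite !measureD ?setIidr//=; first last.
  - by rewrite /pushforward Pray ltry.
  - by rewrite uniform_ray ltry.
  by rewrite /pushforward !uniform_ray !Pray.
- move=> n; have mFn : measurable (F @^-1` g n).
    by rewrite -[X in measurable X]setTI; apply: mF => //; exact: measurable_itv.
  exact: le_lt_trans (probability_le1 P mFn) (ltry _).
Qed.

Lemma integral_cdf_of (g : mR -> \bar R) : measurable_fun [set: mR] g ->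
  (forall s, 0 <= g s)%E ->
  (\int[P]_t g (cdf_of P t) = \int[mu]_(s in `[0%R, 1%R]) g s)%E.
Proof.
move=> mg g0.
transitivity (\int[uniform_prob (@ltr01 R)]_s g s)%E; last first.
  by rewrite integral_uniform// subr0 invr1 mul1e.
transitivity (\int[pushforward P F]_s g s)%E.
  by rewrite ge0_integral_pushforward.
apply: eq_measure_integral => A mA _; exact: pushforward_cdf_of_uniform.
Qed.

(** A set that is downward closed off a null set coincides, up to a null set,
    with the initial segment of the same mass; the integral over it is therefore
    an integral over an initial segment of the uniform law.  The integrand does
    not see which downward closed set was taken, only its mass: this is why the
    local terms of the energy are integrals of a fixed weight over [{A <= x}]
    for every monotone rearrangement [A]. *)
Lemma integral_downset (D S : set mR) (g : mR -> \bar R) :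
  measurable D -> P (~` D) = 0%E -> measurable S ->
  (forall t u, D t -> D u -> t <= u -> S u -> S t) ->
  measurable_fun [set: mR] g -> (forall s, 0 <= g s)%E ->
  (\int[P]_(t in S) g (cdf_of P t) = \int[mu]_(s in `[0%R, fine (P S)]) g s)%E.
Proof.
move=> mD PD mS Sdown mg g0; set s0 := fine (P S).
have s0E : P S = s0%:E by rewrite fineK// fin_num_measure.
have s01 : 0 <= s0 <= 1 by rewrite -!lee_fin -s0E measure_ge0 probability_le1.
pose K := [set t : mR | cdf_of P t <= s0].
have mK : measurable K by exact: measurable_cdf_of_le.
have PK : P K = P S by rewrite cdf_of_uniform.
have PD1 A : measurable A -> P (A `&` D) = P A.
  by move=> mA; exact: measureI_conull.
(* a point of S carries below it only points of S, so its level is at most P S *)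
have SDK : S `&` D `<=` K.
  move=> u [Su Du]; rewrite /K/= -lee_fin EFin_cdf_of -s0E.
  rewrite -(PD1 `]-oo, u]) ?measurable_itv//.
  apply: le_measure; rewrite ?inE//; first exact/measurableI.
  by move=> t [/=]; rewrite in_itv/= => tu Dt; exact: (Sdown _ _ Dt Du tu).
have PKS : P (K `\` S) = 0%E.
  have : P (K `&` S) = P K.
    apply/eqP; rewrite eq_le; apply/andP; split.
      by apply: le_measure; rewrite ?inE//; exact: measurableI.
    rewrite PK -(PD1 S mS); apply: le_measure; rewrite ?inE//; try exact: measurableI.
    by move=> t SDt; split; [exact: SDK|case: SDt].
  have mfin : (P K < +oo)%E by rewrite PK s0E ltry.
  move=> PKIS; rewrite measureD// [X in (_ - X)%E](_ : _ = P K)// subee//; exact: fin_num_measure.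
pose gS := (fun t => g (cdf_of P t)) \_ S; pose gK := (fun t => g (cdf_of P t)) \_ K.
have mgF : measurable_fun [set: mR] (fun t => g (cdf_of P t)).
  exact: (measurableT_comp mg mF).
transitivity (\int[P]_t gK t)%E.
  rewrite integral_mkcond; apply: ge0_ae_eq_integral => //.
  - by apply/(measurable_restrictT _ mS)/measurable_funTS.
  - by apply/(measurable_restrictT _ mK)/measurable_funTS.
  - by move=> t _; apply: erestrict_ge0.
  - by move=> t _; apply: erestrict_ge0.
  exists ((K `\` S) `|` ~` D); split.
  - by apply: measurableU; [exact: measurableD|exact: measurableC].
  - apply/eqP; rewrite eq_le measure_ge0 andbT.
    apply: le_trans (measureU2 _ _ _) _ => //; [exact: measurableD|exact: measurableC|].
    by rewrite [X in (X + _)%E]PKS [X in (_ + X)%E]PD adde0.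
  - move=> t /= h; have [Dt|Dt] := pselect (D t); last by right.
    left; apply: contrapT => nKS; apply: h => _.
    rewrite /gK !patchE; have [St|St] := pselect (S t).
      have Kt : K t by apply: SDK; split.
      by rewrite !mem_set.
    rewrite !memNset// => Kt; exact: nKS.
pose h s := (g s * (\1_(`]-oo, s0]%classic : set mR) s)%:E)%E.
transitivity (\int[P]_t h (cdf_of P t))%E.
  apply: eq_integral => t _; rewrite /gK patchE /h indicE.
  have -> : (cdf_of P t \in (`]-oo, s0]%classic : set mR)) = (t \in K).
    by apply/idP/idP => /set_mem ht; apply/mem_set; move: ht; rewrite /K/= in_itv.
  by case: ifPn; rewrite ?mule1 ?mule0.
rewrite integral_cdf_of; last 2 first.
- apply: emeasurable_funM => //; apply/measurable_EFinP; exact: measurable_indic.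
- by move=> s; rewrite mule_ge0// lee_fin.
rewrite integral_mkcond [RHS]integral_mkcond; apply: eq_integral => s _.
rewrite !patchE /h indicE; have [/andP[_ s1]] := (s01, tt).
have [s_in|s_out] := boolP (s \in `[0, s0]).
  move: s_in; rewrite inE/= in_itv/= => /andP[ss0 ss1].
  by rewrite !mem_set ?mule1//= in_itv/= ?ss0 ?(le_trans ss1).
case: ifPn => // s_in; rewrite memNset ?mule0//= in_itv/= => ss0.
move: s_out => /negP; apply; move: s_in; rewrite !inE/= !in_itv/= ss0.
by move=> /andP[->].
Qed.

End layer.

(** * Unit steps and integrals of distribution functions *)

Section heaviside.
Context {R : realType}.
Local Notation mu := (@lebesgue_measure R).
Local Notation mR := (measurableTypeR R).

Definition heaviside (y x : R) : R := if y <= x then 1 else 0.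

Lemma heaviside_ge0 y x : 0 <= heaviside y x.
Proof. by rewrite /heaviside; case: ifP. Qed.

Lemma heaviside_le1 y x : heaviside y x <= 1.
Proof. by rewrite /heaviside; case: ifP. Qed.

Lemma measurable_heaviside d (T : measurableType d) (f g : T -> R) :
  measurable_fun setT f -> measurable_fun setT g ->
  measurable_fun setT (fun t => heaviside (f t) (g t)).
Proof. by move=> mf mg; apply: measurable_fun_ifT => //; exact: measurable_fun_ler. Qed.

Lemma integral_heaviside_window (a y : R) :
  (\int[mu]_x (heaviside a x * (1 - heaviside y x))%:E = (Num.max 0 (y - a))%:E)%E.
Proof.
transitivity (\int[mu]_(x in `[a, y[) 1%E)%E.
  rewrite [RHS]integral_mkcond; apply: eq_integral => x _.
  rewrite patchE; case: ifPn => [/set_mem/=|/negP h]; rewrite /heaviside.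
    by rewrite in_itv/= => /andP[-> /lt_geF ->]; rewrite subr0 mulr1.
  case: (leP a x) => [ax|]; last by rewrite mul0r.
  case: (leP y x) => [|xy]; first by rewrite subrr mulr0.
  by exfalso; apply: h; apply/mem_set; rewrite /= in_itv/= ax xy.
rewrite integral_cst//= mul1e lebesgue_measure_itv/= lte_fin.
rewrite -subr_gt0; case: (ltP 0 (y - a)) => // _.
Qed.

Lemma abs_heavisideB (y x : R) :
  `|heaviside y x - heaviside 0 x| =
  heaviside y x * (1 - heaviside 0 x) + heaviside 0 x * (1 - heaviside y x).
Proof.
rewrite /heaviside; case: ifP; case: ifP => _ _.
- by rewrite !subrr normr0 !mulr0 addr0.
- by rewrite !subr0 subrr mulr0 addr0 mulr1 normr1.
- by rewrite !subr0 sub0r subrr mulr0 add0r mulr1 normrN normr1.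
- by rewrite !mul0r subrr normr0 addr0.
Qed.

Lemma heavisideB (y x : R) : heaviside y x - heaviside 0 x =
  heaviside y x * (1 - heaviside 0 x) - heaviside 0 x * (1 - heaviside y x).
Proof. ring. Qed.

Let mwin (a y : R) : measurable_fun [set: mR]
  (fun x : mR => (heaviside a x * (1 - heaviside y x))%:E).
Proof.
apply/measurable_EFinP; apply: measurable_funM; first exact: measurable_heaviside.
by apply: measurable_funB => //; exact: measurable_heaviside.
Qed.

Let win_ge0 (a y x : R) : 0 <= heaviside a x * (1 - heaviside y x).
Proof. by rewrite mulr_ge0 ?heaviside_ge0// subr_ge0 heaviside_le1. Qed.

Lemma integral_abs_heavisideB (y : R) :
  (\int[mu]_x `|heaviside y x - heaviside 0 x|%:E = `|y|%:E)%E.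
Proof.
under eq_integral do rewrite abs_heavisideB EFinD.
rewrite ge0_integralD//; [|by move=> x _; rewrite lee_fin win_ge0|by move=> x _; rewrite lee_fin win_ge0].
rewrite !integral_heaviside_window -EFinD sub0r subr0; congr EFin.
have [y0|y0] := leP 0 y.
  by rewrite ger0_norm// max_l ?max_r ?add0r// oppr_le0.
by rewrite ltr0_norm// max_r ?max_l ?addr0 ?oppr_ge0// ltW.
Qed.

Lemma integrable_heavisideB (y : R) :
  mu.-integrable setT (fun x => (heaviside y x - heaviside 0 x)%:E).
Proof.
apply/integrableP; split.
  by apply/measurable_EFinP/measurable_funB; exact: measurable_heaviside.
by under eq_integral do rewrite abse_EFin; rewrite integral_abs_heavisideB ltry.
Qed.

Lemma integral_heavisideB (y : R) :
  (\int[mu]_x (heaviside y x - heaviside 0 x)%:E = (- y)%:E)%E.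
Proof.
under eq_integral do rewrite heavisideB EFinB.
rewrite integralB_EFin//; last 2 first.
- apply/integrableP; split; first exact: mwin.
  by under eq_integral do rewrite gee0_abs ?lee_fin//; rewrite integral_heaviside_window ltry.
- apply/integrableP; split; first exact: mwin.
  by under eq_integral do rewrite gee0_abs ?lee_fin//; rewrite integral_heaviside_window ltry.
rewrite !integral_heaviside_window -EFinB sub0r subr0; congr EFin.
have [y0|y0] := leP 0 y.
  by rewrite max_l ?max_r ?sub0r// oppr_le0.
by rewrite max_r ?max_l ?subr0 ?oppr_ge0// ltW.
Qed.

End heaviside.

Section one_body.
Context {R : realType} d (T : measurableType d).
Local Notation mu := (@lebesgue_measure R).
Local Notation mR := (measurableTypeR R).
Variables (Q : {sigma_finite_measure set T -> \bar R}) (q Y : T -> R).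
Hypotheses (mY : measurable_fun setT Y).
Hypotheses (iq : Q.-integrable setT (EFin \o q)).
Hypotheses (iqY : Q.-integrable setT (fun t => (q t * Y t)%:E)).

(** Without the step at the origin this function would tend to the total weight
    of [q] at [+oo], and would not be integrable. *)
Definition weighted_cdf (x : R) : R :=
  \int[Q]_t (q t * (heaviside (Y t) x - heaviside 0 x)).

Let mq : measurable_fun setT q.
Proof. exact/measurable_EFinP/(measurable_int Q iq). Qed.

Let f (p : mR * T) : \bar R :=
  (q p.2 * (heaviside (Y p.2) p.1 - heaviside 0 p.1))%:E.

Let mf : measurable_fun setT f.
Proof.
apply/measurable_EFinP; apply: measurable_funM.
  exact: (measurableT_comp mq measurable_snd).
apply: measurable_funB; apply: measurable_heaviside => //.
exact: (measurableT_comp mY measurable_snd).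
Qed.

Let integrable_f : (mu \x Q)%E.-integrable setT f.
Proof.
apply/integrable21ltyP => //.
under eq_integral.
  move=> t _; under eq_integral do rewrite /f/= normrM EFinM.
  rewrite ge0_integralZl//; last first.
    apply/measurable_EFinP/measurableT_comp => //.
    by apply: measurable_funB; exact: measurable_heaviside.
  rewrite integral_abs_heavisideB -EFinM -normrM; over.
by move/integrableP : iqY => [_].
Qed.

Let EFin_weighted_cdf x : (weighted_cdf x)%:E = (\int[Q]_t f (x, t))%E.
Proof.
rewrite /weighted_cdf /Rintegral fineK//; apply: integrable_fin_num => //.
apply: (le_integrable measurableT _ _ iq) => //=.
  apply/measurable_EFinP/measurable_funM => //.
  by apply: measurable_funB; exact: measurable_heaviside.
move=> t _; rewrite lee_fin normrM ler_piMr// /heaviside.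
by case: ifP; case: ifP; rewrite ?subrr ?subr0 ?sub0r ?normrN ?normr1 ?normr0.
Qed.

Lemma integrable_weighted_cdf : mu.-integrable setT (EFin \o weighted_cdf).
Proof.
apply: eq_integrable (integrable_fubini_F integrable_f) => // x _.
by rewrite /= EFin_weighted_cdf.
Qed.

(** Exchanging the integrals, a step at [Y] minus the step at the origin
    integrates to [- Y]: total mass turns into position. *)
Lemma integral_weighted_cdf :
  (\int[mu]_x (weighted_cdf x)%:E = (- \int[Q]_t (q t * Y t))%:E)%E.
Proof.
under eq_integral do rewrite EFin_weighted_cdf.
rewrite (Fubini integrable_f) EFinN fineK ?integrable_fin_num//.
rewrite -integralN; last exact: integrable_add_def.
apply: eq_integral => t _.
under eq_integral do rewrite /f/= EFinM.
by rewrite integralZl ?integral_heavisideB -?EFinM ?mulrN//; exact: integrable_heavisideB.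
Qed.

End one_body.

Section two_body.
Context {R : realType} d1 d2 (T1 : measurableType d1) (T2 : measurableType d2).
Local Notation mu := (@lebesgue_measure R).
Local Notation mR := (measurableTypeR R).
Variables (P : {finite_measure set T1 -> \bar R}).
Variables (Q : {finite_measure set T2 -> \bar R}).
Variables (A : T1 -> R) (Y : T2 -> R).
Hypotheses (mA : measurable_fun setT A) (mY : measurable_fun setT Y).

(** The product of the two masses is the mass of the pairs with [A <= x < Y], and
    such [x] fill an interval of length the positive part of [Y - A]. *)
Lemma integral_cdf_ccdf :
  (\int[mu]_x (P [set t | (A t <= x)%R] * Q [set t | (x < Y t)%R]) =
   \int[finite_prod P Q]_z (Num.max 0 (Y z.2 - A z.1))%:E)%E.
Proof.
pose f (p : mR * (T1 * T2)) : \bar R :=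
  (heaviside (A p.2.1) p.1 * (1 - heaviside (Y p.2.2) p.1))%:E.
have mA1 : measurable_fun setT (fun z : T1 * T2 => A z.1).
  exact: (measurableT_comp mA measurable_fst).
have mY2 : measurable_fun setT (fun z : T1 * T2 => Y z.2).
  exact: (measurableT_comp mY measurable_snd).
have mf : measurable_fun setT f.
  apply/measurable_EFinP; apply: measurable_funM.
    apply: measurable_heaviside => //; exact: (measurableT_comp mA1 measurable_snd).
  apply: measurable_funB => //.
  apply: measurable_heaviside => //; exact: (measurableT_comp mY2 measurable_snd).
have f0 p : (0 <= f p)%E.
  by rewrite lee_fin mulr_ge0 ?heaviside_ge0// subr_ge0 heaviside_le1.
transitivity (\int[mu]_x \int[finite_prod P Q]_z f (x, z))%E; last first.
  rewrite (@fubini_tonelli _ _ _ _ _ mu (finite_prod P Q) f)//; apply: eq_integral => z _.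
  exact: (integral_heaviside_window (A z.1) (Y z.2)).
apply: eq_integral => x _.
have mAx : measurable [set t | A t <= x].
  have := measurable_fun_ler mA (measurable_cst x) measurableT (Y := [set true]) I.
  by rewrite setTI.
have mYx : measurable [set t | x < Y t].
  have := measurable_fun_ltr (measurable_cst x) mY measurableT (Y := [set true]) I.
  by rewrite setTI.
rewrite -finite_prodX// -[LHS]mul1e -integral_cst; last exact: measurableX.
rewrite integral_mkcond; apply: eq_integral => -[t u] _.
rewrite patchE; case: ifPn => [/set_mem/=|/negP h]; rewrite /f/= /heaviside.
  by move=> [-> /lt_geF ->]; rewrite subr0 mulr1.
case: (leP (A t) x) => [ax|]; last by rewrite mul0r.
case: (leP (Y u) x) => [|xy]; first by rewrite subrr mulr0.
by exfalso; apply: h; apply/mem_set; rewrite /=.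
Qed.

End two_body.

(** * Reflection, and integrability on products *)

Section reflection.
Context {R : realType}.
Local Notation mu := (@lebesgue_measure R).
Local Notation mR := (measurableTypeR R).

Lemma ge0_integral_reflect (c : R) (f : mR -> \bar R) :
  measurable_fun [set: mR] f -> (forall x, 0 <= f x)%E ->
  (\int[mu]_y f (c - y)%R = \int[mu]_u f u)%E.
Proof.
move=> mf f0; pose phi (y : mR) : mR := c - y.
have mphi : measurable_fun [set: mR] phi by exact: measurable_funB.
transitivity (\int[pushforward mu phi]_u f u)%E.
  by rewrite ge0_integral_pushforward.
apply: eq_measure_integral => A mA _; apply/esym.
apply: lebesgue_measure_unique => //= _ [[a b]] _ <-.
rewrite /pushforward.
have -> : phi @^-1` `]a, b] = `[c - b, c - a[.
  apply/seteqP; split => y /=; rewrite !in_itv/= /phi => /andP[h1 h2].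
    by apply/andP; split; lra.
  by apply/andP; split; lra.
rewrite !lebesgue_measure_itv/= !lte_fin -!EFinD.
have -> : (c - b < c - a) = (a < b) by rewrite ltrD2l ltrN2.
by case: ifP => // _; congr EFin; lra.
Qed.

End reflection.

Section product_integrability.
Context {R : realType} d1 d2 (T1 : measurableType d1) (T2 : measurableType d2).
Variables (P : {finite_measure set T1 -> \bar R}).
Variables (Q : {finite_measure set T2 -> \bar R}).

Lemma integrable_fst (f : T1 -> R) : P.-integrable setT (EFin \o f) ->
  (finite_prod P Q).-integrable setT (fun z => (f z.1)%:E).
Proof.
move=> /integrableP[mf fi].
have mf1 : measurable_fun setT (fun z : T1 * T2 => (f z.1)%:E).
  exact: (measurableT_comp mf measurable_fst).
apply/integrableP; split=> //.
rewrite ge0_integral_finite_prod1//; last exact: measurableT_comp.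
rewrite (eq_integral (fun t => `|(f t)%:E| * Q setT)%E); last first.
  by move=> t _; rewrite -integral_cst.
rewrite ge0_integralZr//; last exact: measurableT_comp.
rewrite lte_mul_pinfty//; first exact: integral_ge0.
  by rewrite ge0_fin_numE ?integral_ge0.
by rewrite -ge0_fin_numE// fin_num_measure.
Qed.

Lemma integrable_snd (f : T2 -> R) : Q.-integrable setT (EFin \o f) ->
  (finite_prod P Q).-integrable setT (fun z => (f z.2)%:E).
Proof.
move=> /integrableP[mf fi].
have mf1 : measurable_fun setT (fun z : T1 * T2 => (f z.2)%:E).
  exact: (measurableT_comp mf measurable_snd).
apply/integrableP; split=> //.
rewrite ge0_integral_finite_prod2//; last exact: measurableT_comp.
rewrite (eq_integral (fun t => `|(f t)%:E| * P setT)%E); last first.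
  by move=> t _; rewrite -integral_cst.
rewrite ge0_integralZr//; last exact: measurableT_comp.
rewrite lte_mul_pinfty//; first exact: integral_ge0.
  by rewrite ge0_fin_numE ?integral_ge0.
by rewrite -ge0_fin_numE// fin_num_measure.
Qed.

End product_integrability.


(** * Entropy along an affine path *)

Section entropy.
Context {R : realType}.
Local Notation mu := (@lebesgue_measure R).

(** The affine correction makes the derivative [ln t - ln a] nonnegative for
    [t >= a], so that integrals of nonnegative functions suffice. *)
Definition entropy (a t : R) : R := t * ln t - (ln a + 1) * t.

(** The factor [k] is [1] for the increasing profile and [-1] for the decreasing
    one, so that the integrand is nonnegative in both cases. *)
Lemma integral_entropy_derivative (a k c0 c1 s : R) : 0 <= s ->
  (forall u : R, 0 <= u <= s -> 0 < c0 + c1 * u) ->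
  (\int[mu]_(u in `[0%R, s]) (k * c1 * (ln (c0 + c1 * u) - ln a))%:E =
   (k * entropy a (c0 + c1 * s) - k * entropy a c0)%:E)%E.
Proof.
move=> s0 pos; have [->|s_neq0] := eqVneq s 0.
  by rewrite set_itv1 integral_set1 mulr0 addr0 subrr.
have {}s0 : 0 < s by rewrite lt_neqAle eq_sym s_neq0.
pose F (u : R) := k * entropy a (c0 + c1 * u).
have dl (u : R) : is_derive u (1 : R) (fun u => c0 + c1 * u) c1.
  apply: is_derive_eq.
  by rewrite add0r mul1r /GRing.scale/= mulr1.
have dF (u : R) : 0 <= u <= s ->
    is_derive u 1 F (k * c1 * (ln (c0 + c1 * u) - ln a)).
  move=> us; have p := pos _ us.
  have dln : is_derive u (1 : R) (fun u => ln (c0 + c1 * u)) (c1 / (c0 + c1 * u)).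
    have := @is_derive1_comp R (@ln R) (fun u : R => c0 + c1 * u) u _ _ (is_derive1_ln p) (dl u).
    by rewrite mulrC.
  rewrite /F /entropy; apply: is_derive_eq.
  rewrite /GRing.scale/= ; field; exact: lt0r_neq0.
have cF u : 0 <= u <= s -> {for u, continuous F}.
  move=> us; apply: differentiable_continuous; apply/derivable1_diffP.
  by case: (dF u us).
rewrite (@continuous_FTC2 _ _ F)//.
- by rewrite /F mulr0 addr0 EFinB.
- apply: continuous_in_subspaceT => u /set_mem/=; rewrite in_itv/= => us.
  have p := pos _ us.
  apply: cvgM; first exact: cvg_cst.
  apply: cvgB; last exact: cvg_cst.
  apply: (@continuous_comp _ _ _ (fun u => c0 + c1 * u) (@ln R)).
    apply: differentiable_continuous; apply/derivable1_diffP.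
    by case: (dl u).
  exact: continuous_ln.
- split.
  + move=> u; rewrite in_itv/= => /andP[u0 us].
    by have us' : 0 <= u <= s; [rewrite !ltW|case: (dF u us')].
  + by apply: cvg_at_right_filter; apply: cF; rewrite lexx ltW.
  + by apply: cvg_at_left_filter; apply: cF; rewrite lexx ltW.
- move=> u; rewrite in_itv/= => /andP[u0 us].
  have us' : 0 <= u <= s by rewrite !ltW.
  by rewrite derive1E; have [_ ->] := dF u us'.
Qed.

End entropy.

(** * The energy as an affine part plus an overlap *)

Section weighted_cdf_expansion.
Context {R : realType} d (T : measurableType d).
Variables (Q : {finite_measure set T -> \bar R}) (q Y : T -> R).
Hypotheses (mY : measurable_fun setT Y).
Hypotheses (iq : Q.-integrable setT (EFin \o q)).

Lemma measurable_sublevel x : measurable [set t | Y t <= x].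
Proof.
have := measurable_fun_ler mY (measurable_cst x) measurableT (Y := [set true]) I.
by rewrite setTI.
Qed.

Lemma weighted_cdfE x : weighted_cdf Q q Y x =
  \int[Q]_(t in [set t | Y t <= x]) q t - heaviside 0 x * \int[Q]_t q t.
Proof.
have mS := measurable_sublevel x.
have -> : heaviside 0 x * \int[Q]_t q t = \int[Q]_t (heaviside 0 x * q t).
  by rewrite RintegralZl.
rewrite Rintegral_mkcond -(@RintegralB _ _ _ Q setT)//; last 2 first.
- rewrite -restrict_EFin; apply/(integrable_mkcond _ mS).
  by apply: integrableS iq.
- by apply: eq_integrable (integrableZl measurableT (heaviside 0 x) iq).
apply: eq_Rintegral => t _; rewrite patchE mulrBr [q t * heaviside 0 x]mulrC.
congr (_ - _); case: ifPn => [/set_mem/= Yx|/negP h]; rewrite /heaviside.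
  by rewrite Yx mulr1.
by case: ifP => Yx; [exfalso; apply: h; apply/mem_set|rewrite mulr0].
Qed.

End weighted_cdf_expansion.

Section energy.
Context {R : realType}.
Local Notation mu := (@lebesgue_measure R).
Local Notation mR := (measurableTypeR R).
Variables (a b kappa beta : R) (j : R -> R).
Hypotheses (a_gt0 : 0 < a) (ab : a < b).
Hypothesis hj : integrable_density j.
Hypothesis j_moment : (\int[mu]_u (`|u| * j u)%:E < +oo)%E.
Variables P1 P2 : probability mR R.
Hypothesis P1_atomless : forall x, P1 [set x] = 0%E.
Hypothesis P2_atomless : forall x, P2 [set x] = 0%E.

Let c := b - a.
Let Jh : R := \int[mu]_s j s.
Let Pj : {finite_measure set mR -> \bar R} := finite_density hj.
Let Q : {finite_measure set (mR * mR)%type -> \bar R} := finite_prod P2 Pj.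

Definition essentially_monotone (P : probability mR R) (A : mR -> mR) : Prop :=
  exists D : set mR, [/\ measurable D, P (~` D) = 0%E &
    forall x y, D x -> D y -> x <= y -> A x <= A y].

Let Pj_setT : Pj setT = Jh%:E.
Proof.
have [mf f0 fi] := hj.
rewrite /Jh /Rintegral fineK//.
by rewrite ge0_fin_numE// integral_ge0// => x _; rewrite lee_fin.
Qed.

Let Q_setT : Q setT = Jh%:E.
Proof.
transitivity (finite_prod P2 Pj (setT `*` setT)); first by rewrite setXTT.
rewrite finite_prodX// [X in (X * _)%E](_ : _ = 1%E) ?mul1e ?Pj_setT//; exact: probability_setT.
Qed.

(** The truncation at zero is only there to have a nonnegative function on all of
    [R]: the logarithms are ordered because [cdf_of] lies between 0 and 1. *)
Definition entropy_weight1 (t : R) : R :=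
  Num.max 0 (c * (ln (a + c * cdf_of P1 t) - ln a)).

Definition entropy_weight2 (t : R) : R :=
  Num.max 0 (c * (ln (b - c * cdf_of P2 t) - ln a)).

Let c_gt0 : 0 < c. Proof. by rewrite /c subr_gt0. Qed.

Let up_ge (s : R) : 0 <= s -> a <= a + c * s.
Proof. by move=> s0; rewrite lerDl mulr_ge0// ltW. Qed.

Let up_le (s : R) : s <= 1 -> a + c * s <= b.
Proof. by move=> s1; rewrite -lerBrDl -/c ler_piMr// ltW. Qed.

Let down_ge (s : R) : s <= 1 -> a <= b - c * s.
Proof. by move=> s1; rewrite lerBrDr -lerBrDl -/c ler_piMr// ltW. Qed.

Let down_le (s : R) : 0 <= s -> b - c * s <= b.
Proof. by move=> s0; rewrite gerBl mulr_ge0// ltW. Qed.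

Let ln_le_sub (t : R) : a <= t -> 0 <= c * (ln t - ln a).
Proof.
move=> at_; rewrite mulr_ge0 ?(ltW c_gt0)// subr_ge0 ler_ln ?posrE//.
exact: lt_le_trans at_.
Qed.

Let ln_sub_le (t : R) : 0 < t -> t <= b -> c * (ln t - ln a) <= c * (ln b - ln a).
Proof.
move=> t0 tb; rewrite ler_pM2l// lerB// ler_ln ?posrE//; exact: lt_trans ab.
Qed.

Let mg1 : measurable_fun [set: mR]
  (fun s : mR => (Num.max 0 (c * (ln (a + c * s) - ln a)))%:E).
Proof.
apply/measurable_EFinP/measurable_maxr => //; apply: measurable_funM => //.
apply: measurable_funB => //; apply: (measurableT_comp (@measurable_ln R)).
by apply: measurable_funD => //; exact: measurable_funM.
Qed.

Let mg2 : measurable_fun [set: mR]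
  (fun s : mR => (Num.max 0 (c * (ln (b - c * s) - ln a)))%:E).
Proof.
apply/measurable_EFinP/measurable_maxr => //; apply: measurable_funM => //.
apply: measurable_funB => //; apply: (measurableT_comp (@measurable_ln R)).
by apply: measurable_funB => //; exact: measurable_funM.
Qed.

Lemma integral_entropy_weight1 (D S : set mR) :
  measurable D -> P1 (~` D) = 0%E -> measurable S ->
  (forall t u, D t -> D u -> t <= u -> S u -> S t) ->
  (\int[P1]_(t in S) (entropy_weight1 t)%:E =
   (entropy a (a + c * fine (P1 S)) - entropy a a)%:E)%E.
Proof.
move=> mD PD mS Sdown.
have S01 : 0 <= fine (P1 S) <= 1.
  by rewrite -!lee_fin fineK ?fin_num_measure// measure_ge0 probability_le1.
have /= -> := integral_downset P1_atomless mD PD mS Sdown mg1.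
  have := @integral_entropy_derivative R a 1 a c (fine (P1 S)).
  rewrite !mul1r => <-.
  - apply: eq_integral => s; rewrite inE/= in_itv/= => /andP[s0 _].
    by rewrite max_r// ln_le_sub// up_ge.
  - by case/andP: S01.
  - by move=> u /andP[u0 _]; exact: lt_le_trans (up_ge u0).
by move=> s; rewrite lee_fin le_max lexx.
Qed.

Lemma integral_entropy_weight2 (D S : set mR) :
  measurable D -> P2 (~` D) = 0%E -> measurable S ->
  (forall t u, D t -> D u -> t <= u -> S u -> S t) ->
  (\int[P2]_(t in S) (entropy_weight2 t)%:E =
   (entropy a b - entropy a (b - c * fine (P2 S)))%:E)%E.
Proof.
move=> mD PD mS Sdown.
have /andP[S0 S1] : 0 <= fine (P2 S) <= 1.
  by rewrite -!lee_fin fineK ?fin_num_measure// measure_ge0 probability_le1.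
have /= -> := integral_downset P2_atomless mD PD mS Sdown mg2.
  have := @integral_entropy_derivative R a (-1) b (- c) (fine (P2 S)).
  have -> : -1 * entropy a (b + - c * fine (P2 S)) - -1 * entropy a b =
    entropy a b - entropy a (b - c * fine (P2 S)) by rewrite (mulNr c); ring.
  move=> <-.
  - apply: eq_integral => s; rewrite inE/= in_itv/= => /andP[s0 sS].
    rewrite mulrNN mul1r (mulNr c) max_r// ln_le_sub// down_ge//.
    exact: le_trans sS S1.
  - exact: S0.
  - move=> u /andP[u0 uS]; apply: lt_le_trans a_gt0 _.
    by rewrite (mulNr c) down_ge// (le_trans uS).
by move=> s; rewrite lee_fin le_max lexx.
Qed.

Lemma integrable_entropy_weight1 : P1.-integrable setT (EFin \o entropy_weight1).
Proof.
apply: (le_integrable measurableT _ _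
  (finite_measure_integrable_cst P1 (c * (ln b - ln a)) measurableT)).
  exact: (measurableT_comp mg1 (measurable_cdf_of P1)).
move=> t _ /=; rewrite lee_fin.
have F0 := cdf_of_ge0 P1 t; have F1 := cdf_of_le1 P1 t.
rewrite /entropy_weight1 max_r ?ln_le_sub ?up_ge// !ger0_norm ?ln_le_sub ?up_ge ?(ltW ab)//.
by apply: ln_sub_le; [exact: lt_le_trans (up_ge F0)|exact: up_le].
Qed.

Lemma integrable_entropy_weight2 : P2.-integrable setT (EFin \o entropy_weight2).
Proof.
apply: (le_integrable measurableT _ _
  (finite_measure_integrable_cst P2 (c * (ln b - ln a)) measurableT)).
  exact: (measurableT_comp mg2 (measurable_cdf_of P2)).
move=> t _ /=; rewrite lee_fin.
have F0 := cdf_of_ge0 P2 t; have F1 := cdf_of_le1 P2 t.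
rewrite /entropy_weight2 max_r ?ln_le_sub ?down_ge// !ger0_norm ?ln_le_sub ?down_ge ?(ltW ab)//.
by apply: ln_sub_le; [exact: lt_le_trans (down_ge F1)|exact: down_le].
Qed.


Section convolution.
Variable B : mR -> mR.
Hypothesis mB : measurable_fun setT B.

Let Y (z : mR * mR) : R := B z.1 + z.2.

Let mY : measurable_fun setT Y.
Proof.
apply: measurable_funD => //; exact: (measurableT_comp mB measurable_fst).
Qed.

Let mj : measurable_fun [set: mR] j.
Proof. by have [] := hj. Qed.

Let j_ge0 s : 0 <= j s.
Proof. by have [] := hj. Qed.

Let F2 (y : R) : R := fine (P2 [set t | B t <= y]).

Let EFin_F2 y : (F2 y)%:E = P2 [set t | B t <= y].
Proof. by rewrite fineK// fin_num_measure//; exact: measurable_sublevel. Qed.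

(** Convolving the distribution function of [B] with [j] gives that of the
    independent sum of [B] and a variable of density [j]. *)
Lemma integral_convolution_cdf (x : R) :
  (\int[mu]_y (j (x - y) * F2 y)%:E = Q [set z | (Y z <= x)%R])%E.
Proof.
pose f (p : mR * mR) : \bar R := (heaviside (B p.1 + p.2) x)%:E.
have mf : measurable_fun setT f.
  by apply/measurable_EFinP; exact: measurable_heaviside.
pose h (p : mR * mR) : \bar R := (j (x - p.2) * heaviside (B p.1) p.2)%:E.
have mh : measurable_fun setT h.
  apply/measurable_EFinP/measurable_funM.
    by apply: (measurableT_comp mj); exact: measurable_funB.
  by apply: measurable_heaviside => //; exact: (measurableT_comp mB measurable_fst).
have h0 p : (0 <= h p)%E by rewrite lee_fin mulr_ge0// heaviside_ge0.
have mSY := measurable_sublevel mY x.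
transitivity (\int[Q]_z f z)%E; last first.
  rewrite -[RHS]mul1e -integral_cst// [RHS]integral_mkcond.
  apply: eq_integral => z _; rewrite patchE /f /heaviside.
  case: (leP (B z.1 + z.2) x) => [zx|xz]; first by rewrite mem_set.
  by rewrite memNset//= /Y leNgt xz.
rewrite [RHS]ge0_integral_finite_prod1//; last first.
  by move=> z; rewrite lee_fin heaviside_ge0.
transitivity (\int[mu]_y \int[P2]_t h (t, y))%E.
  apply: eq_integral => y _; rewrite /h/=.
  under eq_integral do rewrite EFinM.
  rewrite ge0_integralZl//; last 3 first.
  - by apply/measurable_EFinP; exact: measurable_heaviside.
  - by move=> t _; rewrite lee_fin heaviside_ge0.
  - by rewrite lee_fin.
  rewrite EFinM EFin_F2; congr (_ * _)%E.
  rewrite -[LHS]mul1e -integral_cst//; last exact: measurable_sublevel.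
  rewrite integral_mkcond; apply: eq_integral => t _.
  rewrite patchE /heaviside; case: (leP (B t) y) => [ty|yt]; first by rewrite mem_set.
  by rewrite memNset//= leNgt yt.
rewrite -(@fubini_tonelli _ _ _ _ _ P2 mu h)//; apply: eq_integral => t _.
transitivity (\int[mu]_u (f (t, u) * (j u)%:E))%E; last first.
  rewrite ge0_integral_density//.
    by apply/measurable_EFinP; apply: measurable_heaviside => //=; exact: measurable_funD.
  by move=> u; rewrite lee_fin heaviside_ge0.
rewrite -(ge0_integral_reflect x); last 2 first.
- apply: emeasurable_funM; apply/measurable_EFinP => //.
  by apply: measurable_heaviside => //=; exact: measurable_funD.
- by move=> u; rewrite mule_ge0// lee_fin// heaviside_ge0.
apply: eq_integral => y _; rewrite /h /f/= muleC -EFinM; congr (_ * _)%:E.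
by rewrite /heaviside; congr (if _ then _ else _); rewrite addrCA gerDl subr_le0.
Qed.

Let integrable_j_reflect (x : R) :
  mu.-integrable setT (fun y => (j (x - y))%:E).
Proof.
apply/integrableP; split.
  by apply/measurable_EFinP/(measurableT_comp mj); exact: measurable_funB.
have [_ _ jfin] := hj.
under eq_integral do rewrite gee0_abs ?lee_fin//.
rewrite (ge0_integral_reflect x (f := fun u => (j u)%:E))//.
exact/measurable_EFinP.
Qed.

Let Rintegral_j_reflect (x : R) : \int[mu]_y j (x - y) = Jh.
Proof.
congr fine; rewrite (ge0_integral_reflect x (f := fun u => (j u)%:E))//.
exact/measurable_EFinP.
Qed.

Lemma Rintegral_convolution_profile (x u : R) :
  \int[mu]_y (j (x - y) * u * (b - c * F2 y)) =
  u * (b * Jh - c * fine (Q [set z | Y z <= x])).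
Proof.
have mSY := measurable_sublevel mY x.
have ijF : mu.-integrable setT (fun y => (j (x - y) * F2 y)%:E).
  have mF2 : measurable_fun [set: mR] F2.
    apply: nondecreasing_measurable => // s t st.
    rewrite -lee_fin !EFin_F2; apply: le_measure; rewrite ?inE; [exact: measurable_sublevel..|].
    by move=> r /= /le_trans; apply.
  apply: (le_integrable measurableT _ _ (integrable_j_reflect x)).
    apply/measurable_EFinP/measurable_funM => //.
    by apply/(measurableT_comp mj); exact: measurable_funB.
  move=> y _ /=; rewrite lee_fin normrM ler_piMr// ger0_norm ?fine_ge0//.
  by rewrite -lee_fin EFin_F2 probability_le1//; exact: measurable_sublevel.
transitivity (\int[mu]_y (u * b * j (x - y) - u * c * (j (x - y) * F2 y))).
  by apply: eq_Rintegral => y _; ring.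
rewrite RintegralB//; last 2 first.
- by apply: eq_integrable (integrableZl measurableT (u * b) (integrable_j_reflect x)).
- by apply: eq_integrable (integrableZl measurableT (u * c) ijF).
have -> : \int[mu]_y (u * b * j (x - y)) = u * b * Jh.
  have := @RintegralZl _ _ _ mu setT (fun y => j (x - y)) (u * b) measurableT
    (integrable_j_reflect x).
  by rewrite Rintegral_j_reflect.
have -> : \int[mu]_y (u * c * (j (x - y) * F2 y)) = u * c * \int[mu]_y (j (x - y) * F2 y).
  exact: (@RintegralZl _ _ _ mu setT (fun y => j (x - y) * F2 y) (u * c) measurableT ijF).
have -> : \int[mu]_y (j (x - y) * F2 y) = fine (Q [set z | Y z <= x]).
  by rewrite -integral_convolution_cdf.
ring.
Qed.

End convolution.


Let e : R := c * (ln a + 1 - kappa).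
(** What moving a point of the first profile costs: the entropy, in [e] the
    chemical potential and the affine correction inside [entropy], and the share
    of the interaction that is linear in that profile.  For the second profile
    the last share is carried by [Y] instead. *)
Definition position_weight1 (t : R) : R := entropy_weight1 t + (e + beta * a * c * Jh).
Definition position_weight2 (t : R) : R := entropy_weight2 t + e.

Let Y (B : mR -> mR) (z : mR * mR) : R := B z.1 + z.2.

(** The only part of the energy that is not affine in [(A, B)]. *)
Definition overlap (A B : mR -> mR) : R :=
  \int[finite_prod P1 Q]_z Num.max 0 (Y B z.2 - A z.1).

Definition linear_energy (A B : mR -> mR) : R :=
  - (\int[P1]_t (position_weight1 t * A t)) + \int[P2]_t (position_weight2 t * B t)
  + beta * a * c * \int[Q]_z Y B z.

Section energy_formula.
Variables A B : mR -> mR.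
Hypotheses (mA : measurable_fun setT A) (mB : measurable_fun setT B).
Hypotheses (monoA : essentially_monotone P1 A) (monoB : essentially_monotone P2 B).
Hypotheses (iA : P1.-integrable setT (EFin \o A)).
Hypotheses (iB : P2.-integrable setT (EFin \o B)).

Let mY : measurable_fun setT (Y B).
Proof.
apply: measurable_funD => //; exact: (measurableT_comp mB measurable_fst).
Qed.

Let F1 (x : R) : R := fine (P1 [set t | A t <= x]).
Let F2 (x : R) : R := fine (P2 [set t | B t <= x]).
Let FQ (x : R) : R := fine (Q [set z | Y B z <= x]).

Lemma integrable_interaction_position : Q.-integrable setT (EFin \o Y B).
Proof.
have ij : Pj.-integrable setT (EFin \o (@id R)).
  apply/integrableP; split; first exact/measurable_EFinP.
  rewrite ge0_integral_density//.
  by apply/measurable_EFinP; exact: measurableT_comp.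
have := integrableD measurableT (integrable_fst Pj iB) (integrable_snd P2 ij).
by apply: eq_integrable => // z _.
Qed.

Lemma integrable_overlap :
  (finite_prod P1 Q).-integrable setT (fun z => (Num.max 0 (Y B z.2 - A z.1))%:E).
Proof.
have i2 := integrable_snd P1 integrable_interaction_position.
have i1 := integrable_fst Q iA.
have i21 := integrableB measurableT i2 i1.
apply: (le_integrable measurableT _ _ i21) => //.
  apply/measurable_EFinP/measurable_maxr => //.
  apply: measurable_funB; first exact: (measurableT_comp mY measurable_snd).
  exact: (measurableT_comp mA measurable_fst).
move=> z _ /=; rewrite lee_fin ger0_norm ?le_max ?lexx//.
by rewrite ge_max normr_ge0 ler_norm.
Qed.

Let integrable_weightM (P : probability mR R) (q f : mR -> R) (M : R) :
  measurable_fun setT q -> (forall t, `|q t| <= M) ->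
  P.-integrable setT (EFin \o f) -> P.-integrable setT (fun t => (q t * f t)%:E).
Proof.
move=> mq qM fi; apply: (le_integrable measurableT _ _ (integrableZl measurableT M fi)).
  apply/measurable_EFinP/measurable_funM => //.
  by have /integrableP[/measurable_EFinP] := fi.
move=> t _; rewrite /= lee_fin !normrM ler_wpM2r//.
by rewrite (le_trans (qM t))// ler_norm.
Qed.

Let iw1 : P1.-integrable setT (EFin \o position_weight1).
Proof.
have := integrableD measurableT integrable_entropy_weight1
  (finite_measure_integrable_cst P1 (e + beta * a * c * Jh) measurableT).
by apply: eq_integrable => // z _.
Qed.

Let iw2 : P2.-integrable setT (EFin \o position_weight2).
Proof.
have := integrableD measurableT integrable_entropy_weight2
  (finite_measure_integrable_cst P2 e measurableT).
by apply: eq_integrable => // z _.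
Qed.

Let entropy_weight1_bound t : `|entropy_weight1 t| <= c * (ln b - ln a).
Proof.
have F0 := cdf_of_ge0 P1 t; have F1' := cdf_of_le1 P1 t.
rewrite /entropy_weight1 max_r ?ln_le_sub ?up_ge// ger0_norm ?ln_le_sub ?up_ge//.
by apply: ln_sub_le; [exact: lt_le_trans (up_ge F0)|exact: up_le].
Qed.

Let entropy_weight2_bound t : `|entropy_weight2 t| <= c * (ln b - ln a).
Proof.
have F0 := cdf_of_ge0 P2 t; have F1' := cdf_of_le1 P2 t.
rewrite /entropy_weight2 max_r ?ln_le_sub ?down_ge// ger0_norm ?ln_le_sub ?down_ge//.
by apply: ln_sub_le; [exact: lt_le_trans (down_ge F1')|exact: down_le].
Qed.

Lemma integrable_weight1M : P1.-integrable setT (fun t => (position_weight1 t * A t)%:E).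
Proof.
apply: (@integrable_weightM _ _ _ (c * (ln b - ln a) + `|e + beta * a * c * Jh|)) => //.
  by have /integrableP[/measurable_EFinP] := iw1.
by move=> t; rewrite (le_trans (ler_normD _ _))// lerD2r.
Qed.

Lemma integrable_weight2M : P2.-integrable setT (fun t => (position_weight2 t * B t)%:E).
Proof.
apply: (@integrable_weightM _ _ _ (c * (ln b - ln a) + `|e|)) => //.
  by have /integrableP[/measurable_EFinP] := iw2.
by move=> t; rewrite (le_trans (ler_normD _ _))// lerD2r.
Qed.

Let Rintegral_weight1 (S : set mR) (D : set mR) :
  measurable D -> P1 (~` D) = 0%E -> measurable S ->
  (forall t u, D t -> D u -> t <= u -> S u -> S t) ->
  \int[P1]_(t in S) position_weight1 t =
  entropy a (a + c * fine (P1 S)) - entropy a a + (e + beta * a * c * Jh) * fine (P1 S).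
Proof.
move=> mD PD mS Sdown; rewrite RintegralD//; last 2 first.
- by apply: integrableS integrable_entropy_weight1.
- by apply: finite_measure_integrable_cst.
rewrite Rintegral_cst//; congr (_ + _).
by rewrite /Rintegral (integral_entropy_weight1 mD PD mS Sdown).
Qed.

Let Rintegral_weight2 (S : set mR) (D : set mR) :
  measurable D -> P2 (~` D) = 0%E -> measurable S ->
  (forall t u, D t -> D u -> t <= u -> S u -> S t) ->
  \int[P2]_(t in S) position_weight2 t =
  entropy a b - entropy a (b - c * fine (P2 S)) + e * fine (P2 S).
Proof.
move=> mD PD mS Sdown; rewrite RintegralD//; last 2 first.
- by apply: integrableS integrable_entropy_weight2.
- by apply: finite_measure_integrable_cst.
rewrite Rintegral_cst//; congr (_ + _).
by rewrite /Rintegral (integral_entropy_weight2 mD PD mS Sdown).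
Qed.

Let weighted_cdf1E x : weighted_cdf P1 position_weight1 A x =
  entropy a (a + c * F1 x) - entropy a a + (e + beta * a * c * Jh) * F1 x
  - heaviside 0 x * (entropy a b - entropy a a + (e + beta * a * c * Jh)).
Proof.
have [D [mD PD Dmono]] := monoA.
rewrite (weighted_cdfE mA iw1); congr (_ - _ * _).
  apply: (Rintegral_weight1 mD PD); first exact: measurable_sublevel.
  by move=> t u Dt Du tu /=; apply: le_trans; exact: Dmono.
rewrite (Rintegral_weight1 mD PD)// (probability_setT P1)/= !mulr1.
by rewrite (_ : a + c = b) // /c addrC subrK.
Qed.

Let weighted_cdf2E x : weighted_cdf P2 position_weight2 B x =
  entropy a b - entropy a (b - c * F2 x) + e * F2 x
  - heaviside 0 x * (entropy a b - entropy a a + e).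
Proof.
have [D [mD PD Dmono]] := monoB.
rewrite (weighted_cdfE mB iw2); congr (_ - _ * _).
  apply: (Rintegral_weight2 mD PD); first exact: measurable_sublevel.
  by move=> t u Dt Du tu /=; apply: le_trans; exact: Dmono.
rewrite (Rintegral_weight2 mD PD)// (probability_setT P2)/= !mulr1.
by rewrite /c subKr.
Qed.

Let iQ1 : Q.-integrable setT (EFin \o cst 1).
Proof. exact: finite_measure_integrable_cst. Qed.

Let weighted_cdfQE x :
  weighted_cdf Q (cst 1) (Y B) x = FQ x - heaviside 0 x * Jh.
Proof.
rewrite (weighted_cdfE mY iQ1) !Rintegral_cst ?mul1r ?Q_setT//.
- by congr (_ - _ * _); have := congr1 fine Q_setT.
- exact: measurable_sublevel.
Qed.

Let overlap_density x :
  (F1 x * (Jh - FQ x))%:E =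
  (P1 [set t | (A t <= x)%R] * Q [set z | (x < Y B z)%R])%E.
Proof.
have mS1 := measurable_sublevel mA x; have mS := measurable_sublevel mY x.
rewrite EFinM /F1 fineK ?fin_num_measure//; congr (_ * _)%E.
have -> : [set z | x < Y B z] = ~` [set z | Y B z <= x].
  by apply/seteqP; split => z /=; rewrite ltNge => /negP.
have QS : (Q [set z | (Y B z <= x)%R] + Q (~` [set z | (Y B z <= x)%R]) = Jh%:E)%E.
  rewrite -Q_setT -measureU ?setUv//; last by rewrite setICr.
  exact: measurableC.
rewrite EFinB -QS /FQ fineK ?fin_num_measure// addeAC subee ?add0e//.
exact: fin_num_measure.
Qed.

Let overlapE : (\int[mu]_x (F1 x * (Jh - FQ x))%:E = (overlap A B)%:E)%E.
Proof.
under eq_integral do rewrite overlap_density.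
rewrite (integral_cdf_ccdf P1 Q mA mY) /overlap /Rintegral fineK//.
by apply: integrable_fin_num => //; exact: integrable_overlap.
Qed.

Let integrable_overlap_density :
  mu.-integrable setT (fun x => (F1 x * (Jh - FQ x))%:E).
Proof.
have mS1 x := measurable_sublevel mA x; have mS x := measurable_sublevel mY x.
have mF1 : measurable_fun [set: mR] F1.
  apply: nondecreasing_measurable => // s t st.
  apply: fine_le; rewrite ?fin_num_measure//; apply: le_measure; rewrite ?inE//.
  by move=> r /= /le_trans; apply.
have mFQ : measurable_fun [set: mR] FQ.
  apply: nondecreasing_measurable => // s t st.
  apply: fine_le; rewrite ?fin_num_measure//; apply: le_measure; rewrite ?inE//.
  by move=> r /= /le_trans; apply.
apply/integrableP; split.
  by apply/measurable_EFinP/measurable_funM => //; exact: measurable_funB.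
under eq_integral do rewrite gee0_abs ?overlap_density ?mule_ge0//.
under eq_integral do rewrite -overlap_density.
by rewrite overlapE ltry.
Qed.

Variable g : R.
Hypothesis gE : g = b * ln b + a * ln a + beta * Jh * b * a - kappa * b - kappa * a.

Let m (x : R) := a + c * F1 x.
Let n (x : R) := b - c * F2 x.

(** Pointwise in [x], the integrand is a combination of three weighted
    distribution functions and of the overlap density.  The steps at the origin
    cancel: both entropies vary by [entropy a b - entropy a a] in total, and the
    interaction share in [position_weight1] has the same total as that of [Y]. *)
Lemma energy_formula :
  (\int[mu]_x (m x * ln (m x) + n x * ln (n x) - kappa * m x - kappa * n x
     + beta * (\int[mu]_y (j (x - y) * m x * n y)) - g)%:E =
   (linear_energy A B + beta * c ^+ 2 * overlap A B)%:E)%E.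
Proof.
have decomposition x :
    m x * ln (m x) + n x * ln (n x) - kappa * m x - kappa * n x
     + beta * (\int[mu]_y (j (x - y) * m x * n y)) - g =
    weighted_cdf P1 position_weight1 A x - weighted_cdf P2 position_weight2 B x
    - beta * a * c * weighted_cdf Q (cst 1) (Y B) x
    + beta * c ^+ 2 * (F1 x * (Jh - FQ x)).
  rewrite (Rintegral_convolution_profile mB) weighted_cdf1E weighted_cdf2E.
  rewrite weighted_cdfQE gE -/(FQ x) -/(m x) -/(n x) /entropy.
  have -> : b = a + c by rewrite /c addrC subrK.
  rewrite /n /m /e.
  have -> : b = a + c by rewrite /c addrC subrK.
  ring.
have i1 := integrable_weighted_cdf mA iw1 integrable_weight1M.
have i2 := integrable_weighted_cdf mB iw2 integrable_weight2M.
have iQY : Q.-integrable setT (fun z => (cst 1 z * Y B z)%:E).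
  apply: eq_integrable integrable_interaction_position => // z _ /=.
  by rewrite mul1r.
have iQ := integrable_weighted_cdf mY iQ1 iQY.
have iQ' := integrableZl measurableT (beta * a * c) iQ.
have io' := integrableZl measurableT (beta * c ^+ 2) integrable_overlap_density.
under eq_integral do rewrite decomposition EFinD !EFinB (EFinM (beta * a * c)) (EFinM (beta * c ^+ 2)).
rewrite integralD//; [|by apply: integrableB => //; exact: integrableB].
rewrite integralB//; [|exact: integrableB].
rewrite integralB// !integralZl// overlapE.
rewrite (integral_weighted_cdf mA iw1 integrable_weight1M).
rewrite (integral_weighted_cdf mB iw2 integrable_weight2M).
rewrite (integral_weighted_cdf mY iQ1 iQY).
rewrite -!EFinM -!EFinB -EFinD; congr EFin; rewrite /linear_energy.
rewrite (_ : \int[Q]_t (cst 1 t * Y B t) = \int[Q]_z Y B z); last first.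
  by apply: eq_Rintegral => z _ /=; rewrite mul1r.
ring.
Qed.

End energy_formula.

End energy.

(** * Convexity of the overlap and the case of equality *)

Section positive_part.
Context {R : realType}.

Lemma convex_pos (l x0 x1 : R) : 0 < l < 1 ->
  Num.max 0 ((1 - l) * x0 + l * x1) <= (1 - l) * Num.max 0 x0 + l * Num.max 0 x1.
Proof.
move=> /andP[l0 l1]; have l1' : 0 <= 1 - l by rewrite subr_ge0 ltW.
have le_max1 (x : R) : x <= Num.max 0 x by rewrite le_max lexx orbT.
have ge0_max (x : R) : 0 <= Num.max 0 x by rewrite le_max lexx.
rewrite ge_max addr_ge0 ?mulr_ge0 ?(ltW l0)//=.
by rewrite lerD// ler_wpM2l// ltW.
Qed.

Lemma strict_convex_pos (l x0 x1 : R) : 0 < l < 1 -> x0 < 0 < x1 \/ x1 < 0 < x0 ->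
  Num.max 0 ((1 - l) * x0 + l * x1) < (1 - l) * Num.max 0 x0 + l * Num.max 0 x1.
Proof.
move=> /andP[l0 l1] [] /andP[x_lt0 x_gt0].
- rewrite (max_l (ltW x_lt0)) (max_r (ltW x_gt0)) mulr0 add0r gt_max mulr_gt0//=.
  by rewrite gtrDr pmulr_rlt0 ?subr_gt0.
- rewrite (max_r (ltW x_gt0)) (max_l (ltW x_lt0)) mulr0 addr0 gt_max.
  by rewrite mulr_gt0 ?subr_gt0//= gtrDl pmulr_rlt0.
Qed.

End positive_part.

Section ae_tools.
Context {R : realType}.
Local Notation mu := (@lebesgue_measure R).
Local Notation mR := (measurableTypeR R).

Lemma integral0_ae d (T : measurableType d) (P : {measure set T -> \bar R})
    (f : T -> \bar R) : measurable_fun setT f -> (forall x, 0 <= f x)%E ->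
  (\int[P]_x f x = 0)%E -> {ae P, forall x, f x = 0%E}.
Proof.
move=> mf f0 If0.
have /(ae_eq_integral_abs P measurableT mf) : (\int[P]_x `|f x| = 0)%E.
  by under eq_integral do rewrite gee0_abs//.
by apply: filterS => x /(_ I).
Qed.

Lemma ae_meets (P : {measure set mR -> \bar R}) (phi : R -> Prop) (a b : R) :
  {ae P, forall x, phi x} -> (0 < P `]a, b[)%E ->
  exists x, [/\ a < x, x < b & phi x].
Proof.
move=> [N [mN PN subN]] Pab; apply: contrapT => H.
move: Pab; rewrite ltNge => /negP; apply; rewrite -PN.
apply: le_measure; rewrite ?inE//.
move=> x /=; rewrite in_itv/= => /andP[ax xb]; apply: subN => /= phix.
by apply: H; exists x.
Qed.

(** Call [t] good if [u t = v y] for almost all [y] near [t].  Two good points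
    closer than [2 * l] share such a [y], as open intervals have positive mass,
    hence have the same [u]; good points are dense, so chains of them connect
    any two. *)
Lemma ae_constant_of_local (P1 P2 : {measure set mR -> \bar R}) (l : R) (u v : R -> R) :
  (forall a b : R, a < b -> (0 < P1 `]a, b[)%E) ->
  (forall a b : R, a < b -> (0 < P2 `]a, b[)%E) -> 0 < l ->
  {ae P1, forall t, {ae P2, forall y, `|t - y| < l -> u t = v y}} ->
  {ae P2, forall y, {ae P1, forall t, `|t - y| < l -> u t = v y}} ->
  exists k, {ae P1, forall t, u t = k} /\ {ae P2, forall y, v y = k}.
Proof.
move=> P1pos P2pos l0 H1 H2.
have FP1 : Filter (nbhs (almost_everywhere P1)) by apply: ae_filter_ringOfSetsType.
have FP2 : Filter (nbhs (almost_everywhere P2)) by apply: ae_filter_ringOfSetsType.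
pose G t := {ae P2, forall y, `|t - y| < l -> u t = v y}.
have near_eq t t' : G t -> G t' -> t <= t' -> t' - t < 2 * l -> u t = u t'.
  move=> Gt Gt' tt' d.
  have [y [y1 y2 [e1 e2]]] : exists y, [/\ t' - l < y, y < t + l &
      (`|t - y| < l -> u t = v y) /\ (`|t' - y| < l -> u t' = v y)].
    apply: (ae_meets (P := P2)); last by apply: P2pos; lra.
    by apply: filterS2 Gt Gt' => y ? ?; split.
  by rewrite e1 ?e2// ltr_norml; apply/andP; split; lra.
have chain (n : nat) t t' : G t -> G t' -> t <= t' -> t' - t < n%:R * l -> u t = u t'.
  elim: n t t' => [|n IH] t t' Gt Gt' tt' d; first by exfalso; rewrite mul0r in d; lra.
  have [d2|d2] := ltP (t' - t) (2 * l); first exact: near_eq.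
  move: d; rewrite -natr1 mulrDl mul1r => d.
  have [s [s1 s2 Gs]] : exists s, [/\ Num.max t (t' - n%:R * l) < s, s < t + 2 * l & G s].
    apply: (ae_meets (P := P1)) => //; apply: P1pos.
    by rewrite gt_max; apply/andP; split; lra.
  move: s1; rewrite gt_max => /andP[ts ns].
  rewrite (near_eq t s)//; [|lra|lra].
  by apply: IH => //; lra.
have Gconst t t' : G t -> G t' -> u t = u t'.
  wlog tt' : t t' / t <= t'.
    move=> W Gt Gt'; have [tt'|/ltW tt'] := leP t t'; first exact: W.
    by apply/esym; exact: W.
  move=> Gt Gt'.
  apply: (chain (Num.truncn ((t' - t) / l)).+1) => //.
  by rewrite -ltr_pdivrMr// Num.Theory.truncnS_gt.
have [t0 [_ _ Gt0]] : exists t, [/\ 0 < t, t < 1 & G t].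
  by apply: (ae_meets (P := P1)) => //; exact: P1pos ltr01.
have u_const : {ae P1, forall t, u t = u t0}.
  by apply: filterS H1 => t Gt; exact: Gconst.
exists (u t0); split => //.
apply: filterS H2 => y Hy.
have [t [t1 t2 [e1 e2]]] : exists t, [/\ y - l < t, t < y + l &
    (`|t - y| < l -> u t = v y) /\ u t = u t0].
  apply: (ae_meets (P := P1)); last by apply: P1pos; lra.
  by apply: filterS2 Hy u_const => t ? ?; split.
by rewrite -e2 e1// ltr_norml; apply/andP; split; lra.
Qed.

End ae_tools.

Section interpolation.
Context {R : realType}.
Local Notation mu := (@lebesgue_measure R).
Local Notation mR := (measurableTypeR R).

Definition interpolate (l : R) (f g : mR -> mR) (t : mR) : mR :=
  (1 - l) * f t + l * g t.

Lemma Rintegral_affine d (T : measurableType d) (P : {measure set T -> \bar R})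
    (f g : T -> R) (r s : R) :
  P.-integrable setT (EFin \o f) -> P.-integrable setT (EFin \o g) ->
  \int[P]_t (r * f t + s * g t) = r * \int[P]_t f t + s * \int[P]_t g t.
Proof.
move=> fi gi.
rewrite -(RintegralZl r measurableT fi) -(RintegralZl s measurableT gi).
apply: RintegralD => //.
- by apply: eq_integrable (integrableZl measurableT r fi).
- by apply: eq_integrable (integrableZl measurableT s gi).
Qed.

Lemma measurable_interpolate l (f g : mR -> mR) :
  measurable_fun setT f -> measurable_fun setT g ->
  measurable_fun setT (interpolate l f g).
Proof. by move=> mf mg; apply: measurable_funD; apply: measurable_funM. Qed.

Lemma integrable_interpolate (P : {measure set mR -> \bar R}) l (f g : mR -> mR) :
  P.-integrable setT (EFin \o f) -> P.-integrable setT (EFin \o g) ->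
  P.-integrable setT (EFin \o interpolate l f g).
Proof.
move=> fi gi; have := integrableD measurableT
  (integrableZl measurableT (1 - l) fi) (integrableZl measurableT l gi).
by apply: eq_integrable => // t _.
Qed.

End interpolation.

Section convexity.
Context {R : realType}.
Local Notation mu := (@lebesgue_measure R).
Local Notation mR := (measurableTypeR R).
Variables (a b kappa beta : R) (j : R -> R).
Hypotheses (a_gt0 : 0 < a) (ab : a < b).
Hypothesis hj : integrable_density j.
Hypothesis j_moment : (\int[mu]_u (`|u| * j u)%:E < +oo)%E.
Variables P1 P2 : probability mR R.

Let Pj : {finite_measure set mR -> \bar R} := finite_density hj.
Let Q : {finite_measure set (mR * mR)%type -> \bar R} := finite_prod P2 Pj.

Lemma essentially_monotone_interpolate (P : probability mR R) l (T : mR -> mR) :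
  0 <= l <= 1 -> essentially_monotone P T ->
  essentially_monotone P (interpolate l id T).
Proof.
move=> /andP[l0 l1] [D [mD PD mono]]; exists D; split => // x y Dx Dy xy.
by rewrite /interpolate lerD// ler_wpM2l// ?subr_ge0// mono.
Qed.

Variables A B A' B' : mR -> mR.
Hypotheses (mA : measurable_fun setT A) (mB : measurable_fun setT B).
Hypotheses (mA' : measurable_fun setT A') (mB' : measurable_fun setT B').
Hypotheses (iA : P1.-integrable setT (EFin \o A)).
Hypotheses (iB : P2.-integrable setT (EFin \o B)).
Hypotheses (iA' : P1.-integrable setT (EFin \o A')).
Hypotheses (iB' : P2.-integrable setT (EFin \o B')).

Lemma linear_energy_affine l :
  linear_energy a b kappa beta hj P1 P2 (interpolate l A A') (interpolate l B B') =
  (1 - l) * linear_energy a b kappa beta hj P1 P2 A B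
  + l * linear_energy a b kappa beta hj P1 P2 A' B'.
Proof.
rewrite /linear_energy.
set w1 := position_weight1 _ _ _ _ _ _; set w2 := position_weight2 _ _ _ _.
have -> : \int[P1]_t (w1 t * interpolate l A A' t) =
    (1 - l) * \int[P1]_t (w1 t * A t) + l * \int[P1]_t (w1 t * A' t).
  rewrite -Rintegral_affine//; [|exact: integrable_weight1M..].
  by apply: eq_Rintegral => t _; rewrite /interpolate; ring.
have -> : \int[P2]_t (w2 t * interpolate l B B' t) =
    (1 - l) * \int[P2]_t (w2 t * B t) + l * \int[P2]_t (w2 t * B' t).
  rewrite -Rintegral_affine//; [|exact: integrable_weight2M..].
  by apply: eq_Rintegral => t _; rewrite /interpolate; ring.
have -> : \int[Q]_z (interpolate l B B' z.1 + z.2) =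
    (1 - l) * \int[Q]_z (B z.1 + z.2) + l * \int[Q]_z (B' z.1 + z.2).
  rewrite -Rintegral_affine//; [|exact: (integrable_interaction_position hj j_moment)..].
  by apply: eq_Rintegral => t _; rewrite /interpolate; ring.
rewrite -/Q; ring.
Qed.

Let X (A B : mR -> mR) (z : mR * (mR * mR)) : R := B z.2.1 + z.2.2 - A z.1.

(** The defect of convexity of the positive part at one sample point. *)
Let gap (l : R) (z : mR * (mR * mR)) : R :=
  (1 - l) * Num.max 0 (X A B z) + l * Num.max 0 (X A' B' z)
  - Num.max 0 (X (interpolate l A A') (interpolate l B B') z).

Let X_interpolate l z : X (interpolate l A A') (interpolate l B B') z =
  (1 - l) * X A B z + l * X A' B' z.
Proof. by rewrite /X /interpolate; ring. Qed.

Let gap_ge0 l z : 0 < l < 1 -> 0 <= gap l z.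
Proof. by move=> l01; rewrite /gap subr_ge0 X_interpolate convex_pos. Qed.

Let integrable_gap l : (finite_prod P1 Q).-integrable setT (EFin \o gap l).
Proof.
have i0 := integrable_overlap hj j_moment mA mB iA iB.
have i1 := integrable_overlap hj j_moment mA' mB' iA' iB'.
have il := integrable_overlap hj j_moment (measurable_interpolate l mA mA')
  (measurable_interpolate l mB mB') (integrable_interpolate l iA iA')
  (integrable_interpolate l iB iB').
have := integrableB measurableT (integrableD measurableT
  (integrableZl measurableT (1 - l) i0) (integrableZl measurableT l i1)) il.
by apply: eq_integrable => // z _.
Qed.

Let overlap_gap l : \int[finite_prod P1 Q]_z gap l z =
  (1 - l) * overlap hj P1 P2 A B + l * overlap hj P1 P2 A' B'
  - overlap hj P1 P2 (interpolate l A A') (interpolate l B B').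
Proof.
have i0 := integrable_overlap hj j_moment mA mB iA iB.
have i1 := integrable_overlap hj j_moment mA' mB' iA' iB'.
have il := integrable_overlap hj j_moment (measurable_interpolate l mA mA')
  (measurable_interpolate l mB mB') (integrable_interpolate l iA iA')
  (integrable_interpolate l iB iB').
rewrite RintegralB//; last first.
  have := integrableD measurableT
    (integrableZl measurableT (1 - l) i0) (integrableZl measurableT l i1).
  by apply: eq_integrable => // z _.
by rewrite (Rintegral_affine _ _ i0 i1).
Qed.

Lemma overlap_convex l : 0 < l < 1 ->
  overlap hj P1 P2 (interpolate l A A') (interpolate l B B') <=
  (1 - l) * overlap hj P1 P2 A B + l * overlap hj P1 P2 A' B'.
Proof.
move=> l01; rewrite -subr_ge0 -overlap_gap; apply: Rintegral_ge0 => z _.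
exact: gap_ge0.
Qed.

Let ae2_integral0 (P P' : {finite_measure set mR -> \bar R}) (h : mR * mR -> \bar R) :
  measurable_fun setT h -> (forall p, 0 <= h p)%E ->
  (\int[P]_t \int[P']_y h (t, y) = 0)%E ->
  {ae P, forall t, {ae P', forall y, h (t, y) = 0%E}}.
Proof.
move=> mh h0 Ih.
have FP : Filter (nbhs (almost_everywhere P)) by apply: ae_filter_ringOfSetsType.
have : {ae P, forall t, (\int[P']_y h (t, y) = 0)%E}.
  apply: (integral0_ae (f := fun t => \int[P']_y h (t, y))%E) => //.
    exact: measurable_fun_fubini_tonelli_F.
  by move=> t; exact: integral_ge0.
apply: filterS => t It; apply: integral0_ae => //.
exact: (measurableT_comp mh (pair1_measurable t)).
Qed.

Section equality.
Variables (l r : R).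
Hypothesis l01 : 0 < l < 1.
Hypothesis Pj_pos :
  forall x y : R, - r <= x -> x < y -> y <= r -> (0 < Pj `]x, y[)%E.
Hypothesis overlap_eq :
  overlap hj P1 P2 (interpolate l A A') (interpolate l B B') =
  (1 - l) * overlap hj P1 P2 A B + l * overlap hj P1 P2 A' B'.

(** If the offsets differed, the points [u] strictly between [A t - B y] and
    [A' t - B' y] would fill an interval meeting [(-r, r)] in an interval of
    positive mass, and the gap is positive at each of them. *)
Let offsets_agree t y : `|A t - B y| < r ->
  {ae Pj, forall u, gap l (t, (y, u)) = 0} -> A' t - A t = B' y - B y.
Proof.
rewrite ltr_norml => /andP[zr zr'] gap0.
set z0 := A t - B y in zr zr'; pose z1 := A' t - B' y.
suff : z0 = z1 by rewrite /z0 /z1; lra.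
have X0 u : X A B (t, (y, u)) = u - z0 by rewrite /X/= /z0; ring.
have X1 u : X A' B' (t, (y, u)) = u - z1 by rewrite /X/= /z1; ring.
have no_between u : u - z0 < 0 < u - z1 \/ u - z1 < 0 < u - z0 ->
    gap l (t, (y, u)) = 0 -> False.
  move=> /(strict_convex_pos l01) + /eqP.
  by rewrite /gap X_interpolate X0 X1 subr_eq0 => /[swap] /eqP ->; rewrite ltxx.
have [zz|zz|//] := ltgtP z0 z1; exfalso.
- have [u [u1 u2 gu]] : exists u, [/\ z0 < u, u < Num.min z1 r &
      gap l (t, (y, u)) = 0].
    apply: (ae_meets gap0); apply: Pj_pos; first exact: ltW.
      by rewrite lt_min zz.
    by rewrite ge_min lexx orbT.
  move: u2; rewrite lt_min => /andP[u2 _]; apply: (no_between u) => //.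
  by right; apply/andP; split; lra.
- have [u [u1 u2 gu]] : exists u, [/\ Num.max z1 (- r) < u, u < z0 &
      gap l (t, (y, u)) = 0].
    apply: (ae_meets gap0); apply: Pj_pos; last exact: ltW.
      by rewrite le_max lexx orbT.
    by rewrite gt_max zz.
  move: u1; rewrite gt_max => /andP[u1 _]; apply: (no_between u) => //.
  by left; apply/andP; split; lra.
Qed.

Let mgap : measurable_fun setT (fun z => (gap l z)%:E).
Proof. exact: measurable_int (integrable_gap l). Qed.

Let gap0 z : (0 <= (gap l z)%:E)%E.
Proof. by rewrite lee_fin gap_ge0. Qed.

Let h (p : mR * mR) : \bar R := (\int[Pj]_u (gap l (p.1, (p.2, u)))%:E)%E.

Let mh : measurable_fun setT h.
Proof.
pose k (w : (mR * mR) * mR) := (gap l (w.1.1, (w.1.2, w.2)))%:E.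
apply: (measurable_fun_fubini_tonelli_F (m2 := Pj) k); last by move=> w; exact: gap0.
apply: (measurableT_comp mgap).
apply: measurable_fun_pair; first exact: (measurableT_comp measurable_fst measurable_fst).
apply: measurable_fun_pair; first exact: (measurableT_comp measurable_snd measurable_fst).
exact: measurable_snd.
Qed.

Let h0 p : (0 <= h p)%E.
Proof. exact: integral_ge0. Qed.

Let Ih : (\int[P1]_t \int[P2]_y h (t, y) = 0)%E.
Proof.
transitivity (\int[finite_prod P1 Q]_z (gap l z)%:E)%E.
  rewrite ge0_integral_finite_prod1//; apply: eq_integral => t _.
  rewrite ge0_integral_finite_prod1//.
  exact: (measurableT_comp mgap (pair1_measurable t)).
rewrite -[LHS]fineK; last by apply: integrable_fin_num => //; exact: integrable_gap.
by congr EFin; rewrite -[LHS]/(\int[finite_prod P1 Q]_z gap l z) overlap_gap overlap_eq subrr.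
Qed.

Let h_eq0 t y : h (t, y) = 0%E -> `|A t - B y| < r -> A' t - A t = B' y - B y.
Proof.
move=> hty /offsets_agree; apply.
have FP : Filter (nbhs (almost_everywhere Pj)) by apply: ae_filter_ringOfSetsType.
have : {ae Pj, forall u, ((gap l (t, (y, u)))%:E = 0)%E}.
  apply: (integral0_ae (f := fun u => (gap l (t, (y, u)))%:E)) => //.
  apply: (measurableT_comp mgap); apply: measurable_fun_pair => //.
by apply: filterS => u [].
Qed.

Lemma overlap_affine_offsets12 : {ae P1, forall t, {ae P2, forall y,
  `|A t - B y| < r -> A' t - A t = B' y - B y}}.
Proof.
have FP1 : Filter (nbhs (almost_everywhere P1)) by apply: ae_filter_ringOfSetsType.
have FP2 : Filter (nbhs (almost_everywhere P2)) by apply: ae_filter_ringOfSetsType.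
apply: filterS (ae2_integral0 mh h0 Ih) => t; apply: filterS => y; exact: h_eq0.
Qed.

Lemma overlap_affine_offsets21 : {ae P2, forall y, {ae P1, forall t,
  `|A t - B y| < r -> A' t - A t = B' y - B y}}.
Proof.
have FP1 : Filter (nbhs (almost_everywhere P1)) by apply: ae_filter_ringOfSetsType.
have FP2 : Filter (nbhs (almost_everywhere P2)) by apply: ae_filter_ringOfSetsType.
have mh' : measurable_fun setT (fun p : mR * mR => h (p.2, p.1)).
  by apply: (measurableT_comp mh); exact: measurable_fun_pair.
have Ih' : (\int[P2]_y \int[P1]_t h (t, y) = 0)%E.
  by rewrite -(@fubini_tonelli _ _ _ _ _ P1 P2 h).
have h0' p : (0 <= h (p.2, p.1))%E by [].
apply: filterS (ae2_integral0 mh' h0' Ih') => y; apply: filterS => t; exact: h_eq0.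
Qed.

End equality.

End convexity.

(** * The marginal interaction kernel *)

Section marginal_kernel.
Context {R : realType}.
Local Notation mu := (@lebesgue_measure R).
Local Notation mR := (measurableTypeR R).
Variables (nu : nat) (J : R -> R) (L : R).
Hypothesis J_ge0 : forall r, 0 <= r -> 0 <= J r.
Hypothesis J_decreasing : forall r s, 0 <= r -> r <= s -> J s <= J r.
Hypothesis L_ge0 : 0 <= L.
Hypothesis J_support : forall r, L < r -> J r = 0.

Let k := nu.-1.
Let T := k.-tuple mR.
Let norm (s : R) (t : T) : R := Num.sqrt (s ^+ 2 + \sum_(i < k) tnth t i ^+ 2).

Let normE_ge (s : R) (t : T) (i : 'I_k) : `|tnth t i| <= norm s t.
Proof.
rewrite -sqrtr_sqr; apply: ler_wsqrtr.
rewrite (bigD1 i)//= addrCA lerDl addr_ge0 ?sqr_ge0//.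
by apply: sumr_ge0 => j _; exact: sqr_ge0.
Qed.

Let norm_ge (s : R) (t : T) : `|s| <= norm s t.
Proof.
rewrite -sqrtr_sqr; apply: ler_wsqrtr; rewrite lerDl.
by apply: sumr_ge0 => j _; exact: sqr_ge0.
Qed.

Let norm_le (s s' : R) (t : T) : `|s| <= `|s'| -> norm s t <= norm s' t.
Proof.
move=> ss; apply: ler_wsqrtr; rewrite lerD2r -[s ^+ 2]real_normK ?num_real//.
by rewrite -[s' ^+ 2]real_normK ?num_real// lerXn2r ?nnegrE.
Qed.

Let norm_ge0 s t : 0 <= norm s t. Proof. exact: sqrtr_ge0. Qed.

Let measurable_norm s : measurable_fun [set: T] (norm s).
Proof.
have msqrt : measurable_fun [set: R] (@Num.sqrt R).
  by apply: nondecreasing_measurable => // x y; exact: ler_wsqrtr.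
apply: (measurableT_comp msqrt).
apply: measurable_funD => //; apply: measurable_sum => i.
by apply: measurable_funX; exact: measurable_tnth.
Qed.

Let measurable_J_norm s : measurable_fun [set: T] (fun t => J (norm s t)).
Proof.
(* J is only known to be monotone on nonnegative arguments *)
have mJ : measurable_fun [set: R] (fun r => J (Num.max 0 r)).
  apply: nonincreasing_measurable => // r r' rr'.
  apply: J_decreasing; first by rewrite le_max lexx.
  by rewrite ge_max !le_max lexx rr' orbT.
have := measurableT_comp mJ (measurable_norm s).
by congr measurable_fun; apply/funext => t /=; rewrite max_r.
Qed.

Let box (l : R) : set T := [set t | forall i, `[- l, l]%classic (tnth t i)].

Let measurable_box l : measurable (box l).
Proof.
rewrite (_ : box l = \bigcap_(i in [set: 'I_k])
    ((fun t : T => tnth t i) @^-1` `[- l, l]%classic)); last first.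
  by apply/seteqP; split => t /= Ht i; [move=> _; exact: Ht|exact: (Ht i Logic.I)].
apply: fin_bigcap_measurable => // i _.
rewrite -[X in measurable X]setTI; exact: measurable_tnth.
Qed.

Let box_measure l : 0 <= l -> (@lebesgue_tuple R k : {measure set T -> \bar R}) (box l) = ((l + l) ^+ k)%:E.
Proof.
move=> l0; rewrite [LHS](lebesgue_tuple_box (fun=> measurable_itv `[- l, l]%R)).
rewrite (eq_bigr (fun=> (l + l)%:E)); last first.
  move=> i _; rewrite lebesgue_measure_itv/= lte_fin opprK.
  by case: ltP => // ll; congr EFin; lra.
by rewrite prodEFin prodr_const card_ord.
Qed.

Let integrable_J_norm s :
  (@lebesgue_tuple R k).-integrable [set: T] (fun t => (J (norm s t))%:E).
Proof.
have ib : (@lebesgue_tuple R k).-integrable [set: T]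
    (fun t => ((J 0)%:E * (\1_(box L) t)%:E)%E).
  apply: integrableZl => //; apply/integrableP; split.
    by apply/measurable_EFinP; exact: measurable_indic.
  under eq_integral do rewrite gee0_abs ?lee_fin//.
  by rewrite integral_indic// setIT box_measure// ltry.
apply: (le_integrable measurableT _ _ ib); first exact/measurable_EFinP.
move=> t _; rewrite -EFinM lee_fin !ger0_norm ?mulr_ge0 ?J_ge0//.
rewrite indicE; have [tb|/negP tb] := boolP (t \in box L).
  by rewrite mulr1 J_decreasing.
rewrite mulr0 J_support// ltNge; apply/negP => nL; apply: tb.
apply/mem_set => i /=; rewrite in_itv/= -ler_norml.
exact: le_trans (normE_ge s t i) nL.
Qed.

Let JbarE s : Jbar nu J s = \int[@lebesgue_tuple R k]_t J (norm s t).
Proof. by []. Qed.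

Lemma Jbar_ge0 s : 0 <= Jbar nu J s.
Proof. by rewrite JbarE; apply: Rintegral_ge0 => t _; exact: J_ge0. Qed.

Lemma Jbar_decreasing s s' : `|s| <= `|s'| -> Jbar nu J s' <= Jbar nu J s.
Proof.
move=> ss; rewrite !JbarE; apply: le_Rintegral => //; try exact: integrable_J_norm.
by move=> t _; apply: J_decreasing => //; exact: norm_le.
Qed.

Lemma Jbar_support s : L < `|s| -> Jbar nu J s = 0.
Proof.
move=> Ls; rewrite JbarE /Rintegral integral0_eq// => t _.
by rewrite J_support// (lt_le_trans Ls).
Qed.

Lemma measurable_Jbar : measurable_fun [set: R] (Jbar nu J).
Proof.
have mJ : measurable_fun [set: R] (fun r => Jbar nu J (Num.max 0 r)).
  apply: nonincreasing_measurable => // r r' rr'; apply: Jbar_decreasing.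
  have max_ge0 (q : R) : 0 <= Num.max 0 q by rewrite le_max lexx.
  by rewrite !ger0_norm// ge_max max_ge0/= le_max rr' orbT.
have := measurableT_comp mJ (@normr_measurable R setT).
congr measurable_fun; apply/funext => s /=; rewrite max_r//.
by apply/eqP; rewrite eq_le !Jbar_decreasing// normr_id.
Qed.

Let integral_window (C : R) : 0 <= C ->
  (\int[mu]_s (C%:E * (\1_(`[- L, L]%classic : set mR) s)%:E) < +oo)%E.
Proof.
move=> C0; rewrite ge0_integralZl//; last first.
  by apply/measurable_EFinP; exact: measurable_indic.
rewrite integral_indic// setIT/= lebesgue_measure_itv/= lte_fin.
by case: ifP => _; rewrite ?mule0 ?ltry// -EFinB -EFinM ltry.
Qed.

Lemma integrable_density_Jbar : integrable_density (Jbar nu J).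
Proof.
split; [exact: measurable_Jbar|exact: Jbar_ge0|].
apply: le_lt_trans (integral_window (Jbar_ge0 0)).
apply: ge0_le_integral => //.
- by move=> s _; rewrite lee_fin Jbar_ge0.
- by apply/measurable_EFinP; exact: measurable_Jbar.
- apply: measurable_funeM; apply/measurable_EFinP; exact: measurable_indic.
- move=> s _; rewrite -EFinM lee_fin indicE.
  have [sL|/negP sL] := boolP (s \in (`[- L, L]%classic : set mR)).
    by rewrite mulr1 Jbar_decreasing// normr0.
  rewrite mulr0 Jbar_support// ltNge ler_norml; apply/negP => h; apply: sL.
  by apply/mem_set; rewrite /= in_itv.
Qed.

Lemma Jbar_moment : (\int[mu]_s (`|s| * Jbar nu J s)%:E < +oo)%E.
Proof.
have LJ0 : 0 <= L * Jbar nu J 0 by rewrite mulr_ge0// Jbar_ge0.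
apply: le_lt_trans (integral_window LJ0).
apply: ge0_le_integral => //.
- by move=> s _; rewrite lee_fin mulr_ge0// Jbar_ge0.
- apply/measurable_EFinP; apply: measurable_funM; last exact: measurable_Jbar.
  exact: normr_measurable.
- apply: measurable_funeM; apply/measurable_EFinP; exact: measurable_indic.
- move=> s _; rewrite -EFinM lee_fin indicE.
  have [sL|/negP sL] := boolP (s \in (`[- L, L]%classic : set mR)).
    move: sL => /set_mem; rewrite /= in_itv/= -ler_norml => sL.
    by rewrite mulr1 ler_pM// ?Jbar_ge0// Jbar_decreasing// normr0.
  rewrite !mulr0 Jbar_support ?mulr0// ltNge ler_norml; apply/negP => h; apply: sL.
  by apply/mem_set; rewrite /= in_itv.
Qed.

(** By monotonicity [J] is positive on [[0, b[], hence at least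
    [J r0 > 0] on [[0, r0]], where [3 b / 4 <= r0].  For [|s| < b / 2] and [t] in a box of
    half-side [b / (2 (k + 1))] the squared norm is at most
    [b ^ 2 / 4 + b ^ 2 / 4], less than [(3 b / 4) ^ 2]. *)
Lemma Jbar_gt0 (a b : R) : 0 <= a -> a < b ->
  (forall r, a < r -> r < b -> 0 < J r) ->
  forall s, `|s| < b / 2 -> 0 < Jbar nu J s.
Proof.
move=> a0 ab Jab s sb.
have b0 : 0 < b by exact: le_lt_trans ab.
pose r0 := Num.max (3 / 4 * b) ((a + b) / 2).
have Jr0 : 0 < J r0.
  apply: Jab; first by rewrite /r0 lt_max; apply/orP; right; lra.
  by rewrite /r0 gt_max; apply/andP; split; lra.
pose e := b / 2 / k.+1%:R.
have e0 : 0 < e by rewrite /e !divr_gt0.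
have norm_box t : box e t -> norm s t <= r0.
  move=> te; apply: (@le_trans _ _ (3 / 4 * b)); last by rewrite le_max lexx.
  rewrite -[3 / 4 * b]ger0_norm; last by lra.
  rewrite -sqrtr_sqr; apply: ler_wsqrtr.
  have : \sum_(i < k) tnth t i ^+ 2 <= \sum_(i < k) e ^+ 2.
    apply: ler_sum => i _; rewrite -[tnth t i ^+ 2]real_normK ?num_real//.
    rewrite lerXn2r ?nnegrE// ?(ltW e0)// ler_norml.
    by have := te i; rewrite /= in_itv.
  rewrite sumr_const card_ord => sume.
  have : e ^+ 2 *+ k <= (b / 2) ^+ 2.
    rewrite /e expr_div_n -mulrnAl -mulr_natr -mulrA ler_piMr ?sqr_ge0//.
    rewrite ler_pdivrMr ?exprn_gt0// mul1r expr2 -natrM ler_nat.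
    by rewrite (@leq_trans k.+1)// leq_pmulr.
  have : s ^+ 2 <= (b / 2) ^+ 2.
    by rewrite -[s ^+ 2]real_normK ?num_real// lerXn2r ?nnegrE// ?ltW// divr_gt0.
  nra.
rewrite JbarE; apply: (@lt_le_trans _ _ (J r0 * (e + e) ^+ k)).
  by rewrite mulr_gt0// exprn_gt0// addr_gt0.
have -> : J r0 * (e + e) ^+ k =
    \int[@lebesgue_tuple R k]_t (J r0 * \1_(box e) t).
  rewrite /Rintegral; under eq_integral do rewrite EFinM.
  rewrite ge0_integralZl//; last 2 first.
  - by apply/measurable_EFinP; exact: measurable_indic.
  - by rewrite lee_fin ltW.
  by rewrite integral_indic// setIT box_measure ?(ltW e0).
apply: le_Rintegral => //; last 1 first.
- move=> t _; rewrite indicE; have [/set_mem te|_] := boolP (t \in box e).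
    by rewrite mulr1 J_decreasing// norm_box.
  by rewrite mulr0 J_ge0.
- apply: (@eq_integrable _ _ _ _ _ measurableT
    (fun t => ((J r0)%:E * (\1_(box e) t)%:E)%E)) => //.
  apply: integrableZl => //; apply/integrableP; split.
    by apply/measurable_EFinP; exact: measurable_indic.
  under eq_integral do rewrite gee0_abs ?lee_fin//.
  by rewrite integral_indic// setIT box_measure ?(ltW e0)// ltry.
- exact: integrable_J_norm.
Qed.

End marginal_kernel.

(** * Minimizers of the free energy density *)

Section minimizers.
Context {R : realType}.
Variables (nu : nat) (J : R -> R) (kappa beta : R).

Lemma free_energy_infE (m n : R) : minimizer (free_energy nu J kappa beta) m n ->
  free_energy_inf nu J kappa beta = free_energy nu J kappa beta m n.
Proof.
move=> [m0 n0 mn]; rewrite /free_energy_inf; set E := [set _ | _ in _].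
have Emn : E (free_energy nu J kappa beta m n) by exists (m, n).
have lbE : lbound E (free_energy nu J kappa beta m n).
  by move=> _ [[m' n'] [/= m'0 n'0] <-]; exact: mn.
apply/eqP; rewrite eq_le; apply/andP; split; last first.
  by apply: lb_le_inf => //; exists (free_energy nu J kappa beta m n).
by apply: ge_inf => //; exists (free_energy nu J kappa beta m n).
Qed.

(** The entropy has slope [-oo] at zero; the test point [e] is the one at which
    the free energy has decreased by exactly [e]. *)
Lemma minimizer_snd_neq0 (m : R) : ~ minimizer (free_energy nu J kappa beta) m 0.
Proof.
move=> [m0 _ min0].
pose e := expR (kappa - beta * Jhat nu J * m - 1).
have e0 : 0 < e by exact: expR_gt0.
have := min0 m e m0 (ltW e0).
rewrite /free_energy /e expRK -/e mul0r !mulr0 !addr0 subr0 => H.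
suff : 0 <= - e by rewrite oppr_ge0 leNgt e0.
nra.
Qed.

End minimizers.

(** * Densities and monotone transport *)

Section densities.
Context {R : realType}.
Local Notation mu := (@lebesgue_measure R).
Local Notation mR := (measurableTypeR R).

Lemma density_measure_gt0 (f : R -> R) (x y : R) : measurable_fun [set: R] f ->
  (forall t, 0 <= f t) -> x < y ->
  {ae mu, forall t, `]x, y[%classic t -> 0 < f t} ->
  (0 < density_measure f `]x, y[)%E.
Proof.
move=> mf f0 xy fpos; rewrite lt_neqAle; apply/andP; split; last first.
  by apply: integral_ge0 => t _; rewrite lee_fin.
apply/eqP => /esym If.
have FP : Filter (nbhs (almost_everywhere mu)) by apply: ae_filter_ringOfSetsType.
have mxy : measurable (`]x, y[%classic : set mR) by exact: measurable_itv.
have mfxy : measurable_fun (`]x, y[%classic : set mR) (EFin \o f).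
  by apply/measurable_EFinP; exact: measurable_funTS.
have /(ae_eq_integral_abs mu mxy mfxy) f_eq0 :
    (\int[mu]_(t in `]x, y[) `|(EFin \o f) t| = 0)%E.
  by under eq_integral do rewrite gee0_abs ?lee_fin//.
have : {ae mu, forall t, ~ `]x, y[%classic t}.
  apply: filterS2 fpos f_eq0 => t h1 h2 txy.
  by have := h1 txy; have [->] := h2 txy; rewrite ltxx.
move=> [N [mN N0 subN]].
have : (mu `]x, y[ <= mu N)%E.
  apply: le_measure; rewrite ?inE// => t txy; apply: subN => /=.
  by apply.
rewrite N0 lebesgue_measure_itv/= lte_fin xy -EFinB lee_fin leNgt.
by rewrite subr_gt0 xy.
Qed.

Lemma density_prob_atomless (f : R -> R) (hf : probability_density f) x :
  density_prob hf [set x] = 0%E.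
Proof. exact: integral_set1. Qed.

Lemma integrable_id_density (f : R -> R) (hf : probability_density f) :
  finite_first_moment f -> (density_prob hf).-integrable setT (EFin \o @id R).
Proof.
move=> ffm; apply/integrableP; split; first exact/measurable_EFinP.
rewrite [X in (X < _)%E](_ : _ = \int[mu]_x (`|x| * f x)%:E)%E//.
rewrite [LHS](ge0_integral_density (probability_density_integrable hf))//.
apply/measurable_EFinP; exact: normr_measurable.
Qed.

Section transport.
Variables (eta zeta T : R -> R).
Hypotheses (heta : probability_density eta) (hzeta : probability_density zeta).
Hypothesis hT : monotone_transport eta zeta T.

Let P : probability mR R := density_prob heta.

Lemma transport_measurable : measurable_fun [set: mR] (T : mR -> mR).
Proof. by have [] := hT. Qed.

Lemma transport_monotone : essentially_monotone P T.
Proof. by have [_ [D [mD PD mono]] _] := hT; exists D. Qed.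

Lemma transport_integrable : finite_first_moment zeta ->
  P.-integrable setT (EFin \o T).
Proof.
move=> zfm; have mT := transport_measurable; have [_ _ TE] := hT.
apply/integrableP; split; first exact/measurable_EFinP.
have mabs : measurable_fun [set: mR] (fun z : mR => `|z%:E|%E).
  by apply/measurable_EFinP; exact: normr_measurable.
rewrite [X in (X < _)%E](_ : _ = \int[pushforward P (T : mR -> mR)]_z `|z%:E|)%E; last first.
  by rewrite ge0_integral_pushforward.
rewrite [X in (X < _)%E](_ : _ = \int[density_prob hzeta]_z `|z%:E|)%E; last first.
  by apply: eq_measure_integral => A mA _; exact: TE.
by have /integrableP[_] := integrable_id_density hzeta zfm.
Qed.

Lemma transport_cdf z : P [set t | T t <= z] = density_measure zeta `]-oo, z].
Proof.
by have [_ _ TE] := hT; rewrite -TE ?measurable_itv.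
Qed.

End transport.

(** Comparing the masses of half-lines, [x <= T x - k] because [{T <= T x}]
    contains almost all of [`]-oo, x]], and [T x - k <= x] because for [z < T x]
    the set [{T <= z}] is almost contained in it; mass determines the point
    since the distribution function is strictly increasing. *)
Lemma transport_translate (P : probability mR R) (T : mR -> mR) (k : R) (D : set mR) :
  measurable_fun setT T -> measurable D -> P (~` D) = 0%E ->
  (forall x y, D x -> D y -> x <= y -> T x <= T y) ->
  (forall x y : R, x < y -> (0 < P `]x, y[)%E) ->
  (forall z : R, P [set t | T t <= z] = P `]-oo, (z - k)%R]) ->
  forall x, D x -> T x = x + k.
Proof.
move=> mT mD PD mono Ppos Tk x Dx.
have mS z : measurable [set t | T t <= z] by exact: measurable_sublevel.
have PD1 S : measurable S -> P (S `&` D) = P S.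
  by move=> mSS; exact: measureI_conull.
have cdf_lt (s t : R) : s < t -> (P `]-oo, s] < P `]-oo, t])%E.
  move=> st; rewrite (_ : `]-oo, t]%classic = `]-oo, s] `|` `]s, t]); last first.
    apply/seteqP; split => r /=; rewrite !in_itv/=.
      by move=> rt; have [rs|sr] := leP r s; [left|right; rewrite rt].
    by move=> [/le_trans|/andP[_]]; [apply; exact: ltW|].
  rewrite measureU//=; last first.
    apply/seteqP; split => r //=; rewrite !in_itv/= => -[rs /andP[]].
    by rewrite ltNge rs.
  rewrite lteDl ?fin_num_measure//; apply: lt_le_trans (Ppos s t st) _.
  by apply: le_measure; rewrite ?inE//; apply: subset_itvl; rewrite bnd_simp.
apply/eqP; rewrite eq_le; apply/andP; split.
- rewrite leNgt; apply/negP => xT.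
  pose z := (x + k + T x) / 2.
  have : (P [set t | (T t <= z)%R] <= P `]-oo, x])%E.
    rewrite -(PD1 _ (mS z)); apply: le_measure; rewrite ?inE//; first exact: measurableI.
    move=> t [/= Tz Dt]; rewrite in_itv/= leNgt; apply/negP => xt.
    have := mono _ _ Dx Dt (ltW xt); rewrite /z in Tz; lra.
  rewrite Tk leNgt => /negP; apply; apply: cdf_lt; rewrite /z; lra.
- rewrite leNgt; apply/negP => Tx.
  have : (P `]-oo, x] <= P [set t | (T t <= T x)%R])%E.
    rewrite -(PD1 `]-oo, x]) ?measurable_itv//.
    apply: le_measure; rewrite ?inE//; first exact: measurableI.
    by move=> t [/=]; rewrite in_itv/= => tx Dt; exact: mono.
  rewrite Tk leNgt => /negP; apply; apply: cdf_lt; lra.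
Qed.

Lemma ae_eq_cdf (P : probability mR R) (f g : mR -> mR) (z : R) :
  measurable_fun setT f -> measurable_fun setT g ->
  {ae P, forall t, f t = g t} ->
  P [set t | f t <= z] = P [set t | g t <= z].
Proof.
move=> mf mg fg.
have mSf : measurable [set t | f t <= z] by exact: measurable_sublevel.
have mSg : measurable [set t | g t <= z] by exact: measurable_sublevel.
have FP : Filter (nbhs (almost_everywhere P)) by apply: ae_filter_ringOfSetsType.
rewrite -[LHS]mul1e -integral_cst// -[RHS]mul1e -integral_cst//.
rewrite integral_mkcond [RHS]integral_mkcond; apply: ae_eq_integral => //.
- by apply/(measurable_restrictT _ mSf); exact: measurable_cst.
- by apply/(measurable_restrictT _ mSg); exact: measurable_cst.
apply: filterS fg => t fgt _; rewrite !patchE.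
by congr (if _ then _ else _); apply/idP/idP => /set_mem h; apply/mem_set; move: h; rewrite /= fgt.
Qed.

End densities.

(** * The energy along the displacement interpolation *)

Section displacement_energy.
Context {R : realType}.
Local Notation mu := (@lebesgue_measure R).
Local Notation mR := (measurableTypeR R).
Variables (nu : nat) (J : R -> R) (kappa beta rhom rhop : R).
Hypothesis hj : integrable_density (Jbar nu J).
Hypothesis j_moment : (\int[mu]_u (`|u| * Jbar nu J u)%:E < +oo)%E.
Hypothesis hrho : two_minimizers (free_energy nu J kappa beta) rhom rhop.
Variables (eta1 eta2 : R -> R).
Hypotheses (heta1 : probability_density eta1) (heta2 : probability_density eta2).
Hypotheses (moment1 : finite_first_moment eta1) (moment2 : finite_first_moment eta2).
Variables (T1 T2 : R -> R).

Let P1 : probability mR R := density_prob heta1.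
Let P2 : probability mR R := density_prob heta2.

Hypotheses (mT1 : measurable_fun [set: mR] (T1 : mR -> mR)).
Hypotheses (mT2 : measurable_fun [set: mR] (T2 : mR -> mR)).
Hypotheses (monoT1 : essentially_monotone P1 T1).
Hypotheses (monoT2 : essentially_monotone P2 T2).
Hypotheses (iT1 : P1.-integrable setT (EFin \o T1)).
Hypotheses (iT2 : P2.-integrable setT (EFin \o T2)).

Let linear l := linear_energy rhom rhop kappa beta hj P1 P2
  (interpolate l id T1) (interpolate l id T2).
Let interaction l := overlap hj P1 P2 (interpolate l id T1) (interpolate l id T2).

Lemma two_minimizers_gt0 : 0 < rhom.
Proof.
have [rho_lt rhoP] := hrho.
have min1 : minimizer (free_energy nu J kappa beta) rhop rhom by apply/rhoP; left.
have [_ rhom0 _] := min1; rewrite lt_neqAle rhom0 andbT; apply/eqP => rhom_eq0.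
by move: min1; rewrite -rhom_eq0; exact: minimizer_snd_neq0.
Qed.

Lemma excess_free_energy_displacement l : 0 <= l <= 1 ->
  excess_free_energy nu J kappa beta
    (displacement rhom rhop eta1 T1 l) (displacement rhop rhom eta2 T2 l)
  = (linear l + beta * (rhop - rhom) ^+ 2 * interaction l)%:E.
Proof.
move=> l01; have [rho_lt rhoP] := hrho.
have min1 : minimizer (free_energy nu J kappa beta) rhop rhom by apply/rhoP; left.
have energyE := energy_formula two_minimizers_gt0 rho_lt hj j_moment
  (density_prob_atomless heta1) (density_prob_atomless heta2)
  (measurable_interpolate l (@measurable_id _ mR setT) mT1)
  (measurable_interpolate l (@measurable_id _ mR setT) mT2)
  (essentially_monotone_interpolate l01 monoT1)
  (essentially_monotone_interpolate l01 monoT2)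
  (integrable_interpolate l (integrable_id_density heta1 moment1) iT1)
  (integrable_interpolate l (integrable_id_density heta2 moment2) iT2)
  (free_energy_infE min1).
rewrite -energyE /excess_free_energy; apply: eq_integral => x _.
have mE y : displacement rhom rhop eta1 T1 l y =
    rhom + (rhop - rhom) * fine (P1 [set t | interpolate l id T1 t <= y]).
  by [].
have nE y : displacement rhop rhom eta2 T2 l y =
    rhop - (rhop - rhom) * fine (P2 [set t | interpolate l id T2 t <= y]).
  by rewrite /displacement -mulNr opprB.
rewrite mE nE; congr (_ + _ * _ - _)%:E.
by apply: eq_Rintegral => y _; rewrite nE.
Qed.

Lemma linear_displacement l : linear l = (1 - l) * linear 0 + l * linear 1.
Proof.
have i0 (T : R -> R) : interpolate 0 (@id mR) T = id.
  by apply/funext => t; rewrite /interpolate /=; ring.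
have i1 (T : R -> R) : interpolate 1 (@id mR) T = T.
  by apply/funext => t; rewrite /interpolate /=; ring.
rewrite /linear !i0 !i1 linear_energy_affine//.
- exact: two_minimizers_gt0.
- by case: hrho.
- exact: integrable_id_density.
- exact: integrable_id_density.
Qed.

End displacement_energy.

Section displacement_endpoints.
Context {R : realType}.
Local Notation mu := (@lebesgue_measure R).
Local Notation mR := (measurableTypeR R).

Lemma displacement0 (a b : R) (w eta T : R -> R) :
  profile_density a b w eta -> displacement a b eta T 0 = w.
Proof.
move=> [_ wE]; apply/funext => x; rewrite wE /displacement /pushforward.
congr (_ + _ * fine (density_measure _ _)); apply/seteqP.
by split => t /=; rewrite !in_itv/= /interpolated_map subr0 mul1r mul0r addr0.
Qed.

Lemma displacement1 (a b : R) (v eta zeta T : R -> R) :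
  profile_density a b v zeta -> monotone_transport eta zeta T ->
  displacement a b eta T 1 = v.
Proof.
move=> [_ vE] [_ _ TE]; apply/funext => x; rewrite vE /displacement.
congr (_ + _ * fine _); rewrite -[RHS]/(density_measure zeta `]-oo, x]).
rewrite -TE ?measurable_itv// /pushforward; congr (density_measure _ _).
by apply/seteqP; split => t /=; rewrite !in_itv/= /interpolated_map subrr mul0r add0r mul1r.
Qed.

End displacement_endpoints.

Local Open Scope ring_scope.

Theorem theorem5p2 (R : realType) (nu : nat) (J : R -> R)
    (kappa beta betac rhom rhop : R)
    (w1 w2 v1 v2 eta1 eta2 zeta1 zeta2 T1 T2 : R -> R)
    (hnu : (1 <= nu)%N)
    (J_ge0 : forall r, 0 <= r -> 0 <= J r)
    (J_decreasing : forall r s, 0 <= r -> r <= s -> J s <= J r)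
    (J_support : exists L, forall r, 0 <= r -> L < r -> J r = 0)
    (beta_gt0 : 0 < beta)
    (hbetac : critical_beta nu J kappa betac)
    (betac_lt : betac < beta)
    (hrho : two_minimizers (free_energy nu J kappa beta) rhom rhop)
    (hw1 : increasing_profile rhom rhop w1)
    (hw2 : decreasing_profile rhop rhom w2)
    (hv1 : increasing_profile rhom rhop v1)
    (hv2 : decreasing_profile rhop rhom v2)
    (heta1 : profile_density rhom rhop w1 eta1)
    (heta2 : profile_density rhop rhom w2 eta2)
    (hzeta1 : profile_density rhom rhop v1 zeta1)
    (hzeta2 : profile_density rhop rhom v2 zeta2)
    (hT1 : monotone_transport eta1 zeta1 T1)
    (hT2 : monotone_transport eta2 zeta2 T2)
    (moment_eta1 : finite_first_moment eta1)
    (moment_eta2 : finite_first_moment eta2)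
    (moment_zeta1 : finite_first_moment zeta1)
    (moment_zeta2 : finite_first_moment zeta2) :
  let G := excess_free_energy nu J kappa beta in
  let m := displacement rhom rhop eta1 T1 in
  let n := displacement rhop rhom eta2 T2 in
  (forall lambda : R, 0 < lambda -> lambda < 1 ->
     (G (m lambda) (n lambda)
        <= (1 - lambda)%:E * G w1 w2 + lambda%:E * G v1 v2)%E) /\
  ((exists a b : R, [/\ 0 <= a, a < b & forall r, a < r -> r < b -> 0 < J r]) ->
   {ae lebesgue_measure, forall x : R, 0 < eta1 x} ->
   {ae lebesgue_measure, forall x : R, 0 < eta2 x} ->
   forall lambda : R, 0 < lambda -> lambda < 1 ->
     ((G (m lambda) (n lambda)
         = (1 - lambda)%:E * G w1 w2 + lambda%:E * G v1 v2)%E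
      <-> exists c : R, forall x, v1 x = w1 (x - c) /\ v2 x = w2 (x - c))).
Proof.
pose mR := measurableTypeR R.
move=> G m n.
have [L0 L0_support] := J_support.
pose L := Num.max 0 L0.
have L_ge0 : 0 <= L by rewrite le_max lexx.
have L_support r : L < r -> J r = 0.
  by rewrite gt_max => /andP[r0 Lr]; apply: L0_support => //; exact: ltW.
pose hj := integrable_density_Jbar nu J_ge0 J_decreasing L_ge0 L_support.
have j_moment := Jbar_moment nu J_ge0 J_decreasing L_ge0 L_support.
have [rho_lt _] := hrho.
have [pd1 w1E] := heta1; have [pd2 w2E] := heta2.
have [pz1 v1E] := hzeta1; have [pz2 v2E] := hzeta2.
pose P1 : probability mR R := density_prob pd1.
pose P2 : probability mR R := density_prob pd2.
have mid : measurable_fun [set: mR] (@id mR) by exact: measurable_id.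
have iid1 := integrable_id_density pd1 moment_eta1.
have iid2 := integrable_id_density pd2 moment_eta2.
have mT1 := transport_measurable hT1; have mT2 := transport_measurable hT2.
have monoT1 := transport_monotone pd1 hT1.
have monoT2 := transport_monotone pd2 hT2.
have iT1 := transport_integrable pd1 pz1 hT1 moment_zeta1.
have iT2 := transport_integrable pd2 pz2 hT2 moment_zeta2.
pose linear S1 S2 l := linear_energy rhom rhop kappa beta hj P1 P2
  (interpolate l id S1) (interpolate l id S2).
pose interaction S1 S2 l :=
  overlap hj P1 P2 (interpolate l id S1) (interpolate l id S2).
pose K := beta * (rhop - rhom) ^+ 2.
have K_gt0 : 0 < K by rewrite mulr_gt0// exprn_gt0// subr_gt0.
have GE l : 0 <= l <= 1 -> G (m l) (n l) = (linear T1 T2 l + K * interaction T1 T2 l)%:E.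
  by move=> l01; apply: excess_free_energy_displacement.
have l01 : 0 <= (0 : R) <= 1 by rewrite lexx ler01.
have l11 : 0 <= (1 : R) <= 1 by rewrite lexx ler01.
have GwE : G w1 w2 = (linear T1 T2 0 + K * interaction T1 T2 0)%:E.
  by rewrite -GE// /m /n (displacement0 T1 heta1) (displacement0 T2 heta2).
have GvE : G v1 v2 = (linear T1 T2 1 + K * interaction T1 T2 1)%:E.
  by rewrite -GE// /m /n (displacement1 hzeta1 hT1) (displacement1 hzeta2 hT2).
have linearE l : linear T1 T2 l = (1 - l) * linear T1 T2 0 + l * linear T1 T2 1.
  exact: (linear_displacement hj j_moment hrho moment_eta1 moment_eta2 iT1 iT2).
have i0 (S : R -> R) : interpolate 0 (@id mR) S = id.
  by apply/funext => t; rewrite /interpolate /=; ring.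
have i1 (S : R -> R) : interpolate 1 (@id mR) S = S.
  by apply/funext => t; rewrite /interpolate /=; ring.
split=> [l l0 l1|[a [b [a0 ab Jab]]] eta1_gt0 eta2_gt0 l l0 l1].
  have l_in : 0 < l < 1 by rewrite l0.
  have l_in' : 0 <= l <= 1 by rewrite !ltW.
  rewrite (GE l l_in') GwE GvE -!EFinM -EFinD lee_fin linearE.
  have := overlap_convex hj j_moment mid mid mT1 mT2 iid1 iid2 iT1 iT2 l_in.
  rewrite -/(interaction T1 T2 l) => conv.
  have -> : (1 - l) * (linear T1 T2 0 + K * interaction T1 T2 0) +
      l * (linear T1 T2 1 + K * interaction T1 T2 1) =
      (1 - l) * linear T1 T2 0 + l * linear T1 T2 1 +
      K * ((1 - l) * interaction T1 T2 0 + l * interaction T1 T2 1) by ring.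
  by rewrite lerD2l ler_pM2l// /interaction !i0 !i1.
have l_in : 0 < l < 1 by rewrite l0.
have l_in' : 0 <= l <= 1 by rewrite !ltW.
have P_pos (eta : R -> R) (pd : probability_density eta) :
    {ae lebesgue_measure, forall x : R, 0 < eta x} ->
    forall x y : R, x < y -> (0 < density_prob pd `]x, y[%classic)%E.
  move=> eta_gt0 x y xy; have [meta eta_ge0 _] := pd.
  apply: density_measure_gt0 => //.
  have FP : Filter (nbhs (almost_everywhere (@lebesgue_measure R))).
    by apply: ae_filter_ringOfSetsType.
  by apply: filterS eta_gt0 => t ? _.
have P1_pos := P_pos _ pd1 eta1_gt0; have P2_pos := P_pos _ pd2 eta2_gt0.
split.
- rewrite (GE l l_in') GwE GvE -!EFinM -EFinD => -[]; rewrite linearE => E.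
  have {E} overlap_eq : interaction T1 T2 l =
      (1 - l) * overlap hj P1 P2 id id + l * overlap hj P1 P2 T1 T2.
    apply: (mulfI (lt0r_neq0 K_gt0)).
    move: E; rewrite /interaction !i0 !i1 -/(interaction T1 T2 l) => E.
    by apply: (addrI ((1 - l) * linear T1 T2 0 + l * linear T1 T2 1)); rewrite E; ring.
  have b0 : 0 < b by exact: le_lt_trans ab.
  have Pj_pos (x y : R) : - (b / 2) <= x -> x < y -> y <= b / 2 ->
      (0 < finite_density hj `]x, y[%classic)%E.
    move=> bx xy yb; apply: density_measure_gt0 => //.
    + exact: (measurable_Jbar nu J_ge0 J_decreasing L_ge0 L_support).
    + exact: (Jbar_ge0 nu J_ge0).
    + apply: aeW => t /=; rewrite in_itv/= => /andP[xt ty].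
      apply: (Jbar_gt0 nu J_ge0 J_decreasing L_ge0 L_support a0 ab Jab).
      by rewrite ltr_norml; apply/andP; split; lra.
  (* zero is never strictly between the two differences, whence equal offsets *)
  have o12 := overlap_affine_offsets12 j_moment mid mid mT1 mT2 iid1 iid2 iT1 iT2
    l_in Pj_pos overlap_eq.
  have o21 := overlap_affine_offsets21 j_moment mid mid mT1 mT2 iid1 iid2 iT1 iT2
    l_in Pj_pos overlap_eq.
  have b20 : 0 < b / 2 by rewrite divr_gt0.
  have [k [T1k T2k]] := @ae_constant_of_local R P1 P2 (b / 2)
    (fun t => T1 t - t) (fun y => T2 y - y) P1_pos P2_pos b20 o12 o21.
  have v_translate (eta zeta T : R -> R)
      (pd : probability_density eta) : monotone_transport eta zeta T ->
      {ae density_prob pd, forall t, T t - t = k} -> forall x,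
      density_measure zeta `]-oo, x]%classic = density_measure eta `]-oo, (x - k)]%classic.
    move=> hT Tk x; rewrite -(transport_cdf pd hT).
    have FP : Filter (nbhs (almost_everywhere (density_prob pd))).
      by apply: ae_filter_ringOfSetsType.
    rewrite (@ae_eq_cdf _ _ T (fun t => t + k)); last 3 first.
    - exact: transport_measurable hT.
    - exact: measurable_funD.
    - by apply: filterS Tk => t <-; ring.
    rewrite /density_prob; congr (density_measure _ _).
    by apply/seteqP; split => t /=; rewrite in_itv/= lerBrDr.
  exists k => x; rewrite v1E v2E w1E w2E; split; congr (_ + _ * fine _).
  + exact: (v_translate _ _ _ pd1 hT1 T1k).
  + exact: (v_translate _ _ _ pd2 hT2 T2k).
- move=> [k vw].
  (* T1 and T2 agree with S almost everywhere, and S gives the same displacement *)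
  pose S (x : mR) : mR := x + k.
  have mS : measurable_fun [set: mR] S by exact: measurable_funD.
  have monoS (P : probability mR R) : essentially_monotone P S.
    by exists setT; split => //; [rewrite setCT measure0|move=> x y _ _ xy; rewrite lerD2r].
  have iS (P : probability mR R) : P.-integrable setT (EFin \o @id R) ->
      P.-integrable setT (EFin \o S).
    move=> iP; have := integrableD measurableT iP
      (finite_measure_integrable_cst P k measurableT).
    by apply: eq_integrable => // t _.
  have TS (eta zeta T : R -> R) (pd : probability_density eta) :
      monotone_transport eta zeta T ->
      (forall x y : R, x < y -> (0 < density_prob pd `]x, y[%classic)%E) ->
      (forall x, density_measure zeta `]-oo, x]%classic =
        density_measure eta `]-oo, (x - k)]%classic) ->
      forall c d r, displacement c d eta T r = displacement c d eta S r.
    move=> hT P_gt0 zE c d r; have [mT [D [mD PD monoD]] _] := hT.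
    have TSD := @transport_translate _ (density_prob pd) T k D mT mD PD monoD P_gt0.
    have {}TSD : forall x, D x -> T x = S x.
      by apply: TSD => z; rewrite (transport_cdf pd hT) zE.
    apply/funext => x; rewrite /displacement; congr (_ + _ * fine _).
    have := @ae_eq_cdf _ (density_prob pd) (interpolate r id T) (interpolate r id S) x.
    move=> H; apply: H; try exact: measurable_interpolate.
    exists (~` D); split => //; first exact: measurableC.
    by move=> t /= h Dt; apply: h; rewrite /interpolate TSD.
  have cdf_inj (eta zeta : R -> R) (c d x y : R) :
      probability_density eta -> probability_density zeta -> d - c != 0 ->
      c + (d - c) * \int[lebesgue_measure]_(t in `]-oo, x]) zeta t =
      c + (d - c) * \int[lebesgue_measure]_(t in `]-oo, y]) eta t ->
      density_measure zeta `]-oo, x]%classic = density_measure eta `]-oo, y]%classic.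
    move=> pd pz dc /addrI /(mulfI dc) fineE.
    have fz := fin_num_measure (density_prob pz) _ (measurable_itv `]-oo, x]).
    have fe := fin_num_measure (density_prob pd) _ (measurable_itv `]-oo, y]).
    by rewrite -[LHS](fineK fz) -[RHS](fineK fe); congr EFin.
  have z1E x : density_measure zeta1 `]-oo, x]%classic =
      density_measure eta1 `]-oo, (x - k)]%classic.
    apply: (@cdf_inj _ _ rhom rhop) => //; first by rewrite subr_eq0 gt_eqF.
    by rewrite -v1E -w1E; have [] := vw x.
  have z2E x : density_measure zeta2 `]-oo, x]%classic =
      density_measure eta2 `]-oo, (x - k)]%classic.
    apply: (@cdf_inj _ _ rhop rhom) => //; first by rewrite subr_eq0 lt_eqF.
    by rewrite -v2E -w2E; have [] := vw x.
  have TS1 := TS _ _ _ pd1 hT1 P1_pos z1E.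
  have TS2 := TS _ _ _ pd2 hT2 P2_pos z2E.
  have GSE r : 0 <= r <= 1 -> G (m r) (n r) = (linear S S r + K * interaction S S r)%:E.
    move=> r01; rewrite /m /n TS1 TS2.
    apply: excess_free_energy_displacement => //; exact: iS.
  (* both positions are shifted alike, so their difference does not move *)
  have interactionS r : interaction S S r = interaction S S 0.
    apply: eq_Rintegral => z _; congr (Num.max 0 _).
    by rewrite /interpolate /S/=; ring.
  have linearSE : linear S S l = (1 - l) * linear S S 0 + l * linear S S 1.
    apply: linear_displacement => //; exact: iS.
  have -> : w1 = m 0 by rewrite /m (displacement0 T1 heta1).
  have -> : w2 = n 0 by rewrite /n (displacement0 T2 heta2).
  have -> : v1 = m 1 by rewrite /m (displacement1 hzeta1 hT1).
  have -> : v2 = n 1 by rewrite /n (displacement1 hzeta2 hT2).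
  rewrite !GSE// -!EFinM -EFinD linearSE (interactionS l) (interactionS 1).
  by congr EFin; ring.
Qed.
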